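(* Let $B$ be a compact flat $n$-manifold and let $f$ be a positive definite rational quadratic form of rank $n$. If $B$ appears as a cusp cross-section in a quasi-arithmetic hyperbolic manifold associated to the form $f\oplus\langle 1,-1\rangle$, then $B$ has a holonomy representation with image in $O(f;\mathbb{Q})$.
   Context: Quadratic forms: a rational quadratic form of rank $n$ is a non-degenerate form $q(v)=v^TQv$ on $\mathbb{Q}^n$ with $Q\in GL_n(\mathbb{Q})$ symmetric. For a subring $R\subseteq\mathbb{R}$, $O(q;R)=\{A\in GL_n(R)\mid A^TQA=Q\}$. $\langle a_1,\dots,a_n\rangle$ denotes the diagonal form with these coefficients. Flat manifolds: let $B$ be a compact flat $n$-manifold, with fundamental group $\Gamma_B$ embedded as a discrete subgroup of $O(n)\ltimes\mathbb{R}^n$. The subgroup $T\le\Gamma_B$ of translations is normal, isomorphic to $\mathbb{Z}^n$ and of finite index; $H=\Gamma_B/T$ is the (finite) holonomy group of $B$. Fixing an identification $T\cong\mathbb{Z}^n$, conjugation of $\Gamma_B$ on $T$ induces a faithful representation $\rho_{\mathrm{hol}}:H\to GL_n(\mathbb{Z})$. A holonomy representation of $B$ is any representation $H\to GL_n(\mathbb{R})$ conjugate (in $GL_n(\mathbb{R})$) to $\rho_{\mathrm{hol}}$. Hyperbolic manifolds: let $q$ be a rational quadratic form of signature $(n+1,1)$. $\mathbb{H}_q^{n+1}$ denotes one of the two sheets of $\{x\in\mathbb{R}^{n+2}\mid q(x)=-1\}$ with the metric induced by $q$ (a model of hyperbolic $(n+1)$-space), and $O^+(q;\mathbb{R})$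 is the index-two subgroup of $O(q;\mathbb{R})$ preserving it, which is its isometry group; $O^+(q;\mathbb{Q})=O^+(q;\mathbb{R})\cap GL_{n+2}(\mathbb{Q})$. A quasi-arithmetic hyperbolic manifold associated to $q$ is a finite-volume hyperbolic manifold of the form $\mathbb{H}_q^{n+1}/\Gamma$, where $\Gamma\le O^+(q;\mathbb{R})$ is discrete, torsion-free and commensurable to a subgroup of $O^+(q;\mathbb{Q})$ (two groups are commensurable if their intersection has finite index in both). $B$ appears as a cusp cross-section in a hyperbolic manifold $M$ if $M$ has a cusp diffeomorphic to $B\times\mathbb{R}_{\ge0}$. *)

(* Defs.v *)
From HB Require Import structures.
From mathcomp Require Import all_boot all_order all_algebra.
From mathcomp Require Import all_classical all_reals all_analysis.

Set Implicit Arguments.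
Unset Strict Implicit.
Unset Printing Implicit Defensive.

Import Order.TTheory GRing.Theory Num.Theory.
Import numFieldNormedType.Exports.

Local Open Scope classical_set_scope.
Local Open Scope ring_scope.

(** * Rational quadratic forms *)

Definition form_value (K : comUnitRingType) (n : nat) (Q : 'M[K]_n)
    (v : 'cV[K]_n) : K :=
  (v^T *m Q *m v) 0 0.

Definition rational_quadratic_form (n : nat) (Q : 'M[rat]_n) : Prop :=
  Q^T = Q /\ Q \in unitmx.

Definition positive_definite (n : nat) (Q : 'M[rat]_n) : Prop :=
  forall v : 'cV[rat]_n, v != 0 -> 0 < form_value Q v.

Definition osum (K : comUnitRingType) (m n : nat) (Q1 : 'M[K]_m)
    (Q2 : 'M[K]_n) : 'M[K]_(m + n) :=
  block_mx Q1 0 0 Q2.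

(* <a>, a form of rank one *)
Definition form1 (K : comUnitRingType) (a : K) : 'M[K]_1 := a%:M.

Definition to_real (R : realType) (m n : nat) (A : 'M[rat]_(m, n)) :
    'M[R]_(m, n) :=
  map_mx (@ratr R) A.

(* O(q;K) *)
Definition orthogonal_group (K : comUnitRingType) (n : nat) (Q : 'M[K]_n) :
    set 'M[K]_n :=
  [set A | A \in unitmx /\ A^T *m Q *m A = Q].

(* O(q;Q), viewed inside GL_n(R) *)
Definition rational_orthogonal_group (R : realType) (n : nat) (Q : 'M[rat]_n) :
    set 'M[R]_n :=
  [set to_real R A | A in orthogonal_group Q].

(** * Groups of real matrices *)

Section MatrixGroups.
Variables (R : realType) (n : nat).
Implicit Types G H : set 'M[R]_n.

Definition matrix_group G : Prop :=
  [/\ G 1%:M,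
      forall g h, G g -> G h -> G (g *m h) &
      forall g, G g -> g \in unitmx /\ G (invmx g)].

Definition discrete_group G : Prop := forall g, G g -> isolated G g.

Definition torsion_free G : Prop :=
  forall g (k : nat), G g -> (0 < k)%N -> g ^+ k = 1%:M -> g = 1%:M.

Definition left_coset H (g : 'M[R]_n) : set 'M[R]_n :=
  [set g *m h | h in H].

Definition cosets G H : set (set 'M[R]_n) := [set left_coset H g | g in G].

Definition commensurable G H : Prop :=
  finite_set (cosets G (G `&` H)) /\ finite_set (cosets H (G `&` H)).

Definition orbit (m : nat) (act : 'M[R]_n -> 'cV[R]_m -> 'cV[R]_m) G
    (x : 'cV[R]_m) : set 'cV[R]_m :=
  [set act g x | g in G].

End MatrixGroups.

(** * Diffeomorphisms of quotients *)

Fixpoint iterated_derivative (R : realType) (a b : nat) (vs : seq 'cV[R]_a)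
    (f : 'cV[R]_a -> 'cV[R]_b) : 'cV[R]_a -> 'cV[R]_b :=
  if vs is v :: vs' then
    fun x => derive (iterated_derivative vs' f) x v
  else f.

(* C^oo on an open set V: all iterated directional derivatives exist and are
   continuous on V *)
Definition smooth_on (R : realType) (a b : nat) (V : set 'cV[R]_a)
    (f : 'cV[R]_a -> 'cV[R]_b) : Prop :=
  forall (vs : seq 'cV[R]_a) (x : 'cV[R]_a), V x ->
    {for x, continuous (iterated_derivative vs f)} /\
    forall v : 'cV[R]_a, derivable (iterated_derivative vs f) x v.

(* [pX] and [pY] are the projections of the submanifolds (possibly with
   boundary) X of R^a and Y of R^b onto their quotients by groups acting
   properly discontinuously and freely; points of the quotients are represented
   by orbits.  As the projections are local diffeomorphisms, a map F between the
   quotients is smooth iff near each point it is induced by a smooth map from X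
   to Y; and a map on X is smooth iff it extends locally to a smooth map on an
   open subset of R^a. *)
Definition smooth_quotient_map (R : realType) (a b : nat)
    (X : set 'cV[R]_a) (pX : 'cV[R]_a -> set 'cV[R]_a)
    (Y : set 'cV[R]_b) (pY : 'cV[R]_b -> set 'cV[R]_b)
    (F : set 'cV[R]_a -> set 'cV[R]_b) : Prop :=
  forall x, X x ->
    exists (V : set 'cV[R]_a) (phi : 'cV[R]_a -> 'cV[R]_b),
      [/\ open V, V x, smooth_on V phi &
          forall y, V y -> X y -> Y (phi y) /\ F (pX y) = pY (phi y)].

Definition diffeomorphic_quotients (R : realType) (a b : nat)
    (X : set 'cV[R]_a) (pX : 'cV[R]_a -> set 'cV[R]_a)
    (Y : set 'cV[R]_b) (pY : 'cV[R]_b -> set 'cV[R]_b) : Prop :=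
  exists (F : set 'cV[R]_a -> set 'cV[R]_b) (F' : set 'cV[R]_b -> set 'cV[R]_a),
    [/\ smooth_quotient_map X pX Y pY F,
        smooth_quotient_map Y pY X pX F',
        forall x, X x -> F' (F (pX x)) = pX x &
        forall y, Y y -> F (F' (pY y)) = pY y].

(** * Compact flat manifolds *)

Section FlatManifolds.
Variables (R : realType) (n : nat).
Implicit Types G : set 'M[R]_(n + 1).

(* O(n) |x R^n: the isometry v |-> A v + b is the affine matrix [A b; 0 1]. *)
Definition euclidean_isometries : set 'M[R]_(n + 1) :=
  [set g | exists (A : 'M[R]_n) (b : 'cV[R]_n),
     A^T *m A = 1%:M /\ g = block_mx A b 0 1%:M].

Definition affine_act (g : 'M[R]_(n + 1)) (v : 'cV[R]_n) : 'cV[R]_n :=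
  ulsubmx g *m v + ursubmx g.

(* Compactness of R^n/G; the open subsets of R^n/G are the images of the
   G-invariant open subsets of R^n. *)
Definition compact_quotient G : Prop :=
  forall U : set (set 'cV[R]_n),
    (forall A, U A -> open A /\ forall g v, G g -> A v -> A (affine_act g v)) ->
    (forall v, exists2 A, U A & A v) ->
    exists U' : set (set 'cV[R]_n),
      [/\ finite_set U', U' `<=` U & forall v, exists2 A, U' A & A v].

(* G is the fundamental group of the compact flat manifold R^n/G. *)
Definition compact_flat_manifold_group G : Prop :=
  [/\ G `<=` euclidean_isometries, matrix_group G, discrete_group G,
      torsion_free G & compact_quotient G].

Definition translations G : set 'M[R]_(n + 1) :=
  [set g | G g /\ ulsubmx g = 1%:M].

Definition holonomy_group G : set (set 'M[R]_(n + 1)) :=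
  cosets G (translations G).

(* tau identifies Z^n with the translation subgroup T. *)
Definition lattice_identification G (tau : 'cV[int]_n -> 'M[R]_(n + 1)) : Prop :=
  set_bij setT (translations G) tau /\
  forall z z', tau (z + z') = tau z *m tau z'.

(* rho : H -> GL_n(Z) is induced by the conjugation of G on T; it is
   determined on H by tau and is automatically a homomorphism. *)
Definition rho_hol G (tau : 'cV[int]_n -> 'M[R]_(n + 1))
    (rho : set 'M[R]_(n + 1) -> 'M[int]_n) : Prop :=
  forall g, G g -> rho (left_coset (translations G) g) \in unitmx /\
    forall z, g *m tau z *m invmx g =
              tau (rho (left_coset (translations G) g) *m z).

Definition holonomy_representation G (tau : 'cV[int]_n -> 'M[R]_(n + 1))
    (sigma : set 'M[R]_(n + 1) -> 'M[R]_n) : Prop :=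
  exists (rho : set 'M[R]_(n + 1) -> 'M[int]_n) (P : 'M[R]_n),
    [/\ rho_hol G tau rho, P \in unitmx &
        forall h, holonomy_group G h ->
          sigma h = P *m map_mx intr (rho h) *m invmx P].

(* R^n x R_{>=0}, and the projection onto (R^n/G) x R_{>=0} *)
Definition half_space : set 'cV[R]_(n + 1) := [set x | 0 <= dsubmx x 0 0].

Definition half_space_act (g : 'M[R]_(n + 1)) (x : 'cV[R]_(n + 1)) :
    'cV[R]_(n + 1) :=
  col_mx (affine_act g (usubmx x)) (dsubmx x).

Definition half_space_orbit G : 'cV[R]_(n + 1) -> set 'cV[R]_(n + 1) :=
  orbit half_space_act G.

End FlatManifolds.

(** * Hyperbolic manifolds of a form q = p + <-1> with p positive definite *)

(* The iterated integral over R^m with respect to the Lebesgue measure; it is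
   the Lebesgue integral for nonnegative Borel functions, by Tonelli. *)
Fixpoint iterated_integral (R : realType) (m : nat) :
    ('cV[R]_m -> \bar R) -> \bar R :=
  match m with
  | 0 => fun F => F 0
  | m'.+1 => fun F =>
      (\int[@lebesgue_measure R]_(t in setT)
         iterated_integral (fun w : 'cV[R]_m' =>
           F (col_mx (t%:M : 'cV[R]_1) w)))%E
  end.

Section Hyperbolic.
Variables (R : realType) (m : nat) (p : 'M[rat]_m).

Definition lorentz : 'M[rat]_(m + 1) := osum p (form1 (-1)).

Let Q : 'M[R]_(m + 1) := to_real R lorentz.
Let P : 'M[R]_m := to_real R p.

(* the last coordinate, whose sign separates the two sheets of q = -1 *)
Definition height (x : 'cV[R]_(m + 1)) : R := dsubmx x 0 0.

Definition hyperbolic_space : set 'cV[R]_(m + 1) :=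
  [set x | form_value Q x = -1 /\ 0 < height x].

Definition Oplus : set 'M[R]_(m + 1) :=
  [set A | orthogonal_group Q A /\
     [set A *m x | x in hyperbolic_space] = hyperbolic_space].

Definition rational_Oplus : set 'M[R]_(m + 1) :=
  [set A | Oplus A /\
     exists B : 'M[rat]_(m + 1), B \in unitmx /\ A = to_real R B].

(* The sheet is the graph z = sqrt (1 + p(w)) over R^m.  In the coordinates w
   the metric induced by q is P - dz dz^T, with dz = z^-1 P w. *)
Definition graph_height (w : 'cV[R]_m) : R := Num.sqrt (1 + form_value P w).

Definition metric_tensor (w : 'cV[R]_m) : 'M[R]_m :=
  P - (graph_height w ^- 2) *: ((P *m w) *m (P *m w)^T).

Definition hyperbolic_volume (D : set 'cV[R]_(m + 1)) : \bar R :=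
  iterated_integral (fun w : 'cV[R]_m =>
    (Num.sqrt (\det (metric_tensor w)) *
     \1_D (col_mx w ((graph_height w)%:M : 'cV[R]_1)))%:E).

Definition hyperbolic_orbit (G : set 'M[R]_(m + 1)) :
    'cV[R]_(m + 1) -> set 'cV[R]_(m + 1) :=
  orbit (fun (g : 'M[R]_(m + 1)) (x : 'cV[R]_(m + 1)) => g *m x) G.

(* The volume of the quotient is that of any Borel set of representatives of
   the orbits. *)
Definition finite_covolume (G : set 'M[R]_(m + 1)) : Prop :=
  exists D : set 'cV[R]_(m + 1),
    [/\ <<s [set A : set 'cV[R]_(m + 1) | open A] >> D,
        D `<=` hyperbolic_space,
        forall x, hyperbolic_space x ->
          exists! y, D y /\ hyperbolic_orbit G x y &
        (hyperbolic_volume D < +oo)%E].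

(* G is the fundamental group of the quasi-arithmetic hyperbolic manifold
   hyperbolic_space/G. *)
Definition quasi_arithmetic_manifold_group (G : set 'M[R]_(m + 1)) : Prop :=
  [/\ G `<=` Oplus /\ matrix_group G, discrete_group G, torsion_free G,
      finite_covolume G &
      exists G' : set 'M[R]_(m + 1),
        [/\ G' `<=` rational_Oplus, matrix_group G' & commensurable G G']].

(* The points at infinity are the rays spanned by the future isotropic
   vectors. *)
Definition future_isotropic (xi : 'cV[R]_(m + 1)) : Prop :=
  form_value Q xi = 0 /\ 0 < height xi.

Definition parabolic_at (g : 'M[R]_(m + 1)) (xi : 'cV[R]_(m + 1)) : Prop :=
  [/\ forall x, hyperbolic_space x -> g *m x <> x,
      exists c : R, g *m xi = c *: xi &
      forall eta, future_isotropic eta -> (exists c : R, g *m eta = c *: eta) ->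
        exists c : R, eta = c *: xi].

(* The closed horoball of level 1 determined by xi; rescaling xi gives all the
   horoballs centered at the same point at infinity. *)
Definition horoball (xi : 'cV[R]_(m + 1)) : set 'cV[R]_(m + 1) :=
  [set x | hyperbolic_space x /\ -1 <= (x^T *m Q *m xi) 0 0].

(* The image of [horoball xi] in hyperbolic_space/G is a cusp: the horoball is
   centered at a parabolic fixed point of G and is precisely invariant. *)
Definition cusp_horoball (G : set 'M[R]_(m + 1)) (xi : 'cV[R]_(m + 1)) : Prop :=
  [/\ future_isotropic xi,
      exists2 g, G g & parabolic_at g xi &
      forall g, G g ->
        [set g *m x | x in horoball xi] = horoball xi \/
        [set g *m x | x in horoball xi] `&` horoball xi = set0].

End Hyperbolic.

(* The flat manifold R^n/GB appears as a cusp cross-section in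
   hyperbolic_space/G: some cusp is diffeomorphic to (R^n/GB) x R_{>=0}. *)
Definition cusp_cross_section (R : realType) (n m : nat) (p : 'M[rat]_m)
    (GB : set 'M[R]_(n + 1)) (G : set 'M[R]_(m + 1)) : Prop :=
  exists xi : 'cV[R]_(m + 1),
    cusp_horoball p G xi /\
    diffeomorphic_quotients (@half_space R n) (half_space_orbit GB)
      (horoball p xi) (hyperbolic_orbit G).

(* Main.v *)
Require Import Defs.
From mathcomp Require Import all_boot all_order all_algebra.
From mathcomp Require Import all_classical all_reals all_analysis.
From mathcomp Require Import ring lra.

(** Let q be the form f + <1> + <-1>, let G be the fundamental group of the
    hyperbolic manifold, and let xi be the isotropic vector at the center of the
    horoball that covers the cusp. An isometry of q that fixes xi acts on the
    quotient of the orthogonal complement of xi by xi, a positive definite space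
    of dimension n, and on the horospheres at xi, which are Euclidean n-spaces,
    by an affine isometry with this linear part.

    From topology to algebra. Half space is convex, and the horoball is a graph
    over a convex set ([horo_base]), so the lifting criterion [exists_lift]
    applies to the given diffeomorphism and to its inverse. The result is an
    equivariant embedding of universal covers ([cusp_embedding]), hence an
    injective homomorphism theta from the crystallographic group GB to the
    stabilizer of xi in G; precise invariance of the horoball and
    [horo_stabilizer] show that the image fixes xi itself.

    Translations. The image under theta of the translation lattice is a discrete
    group of isometries of Euclidean n-space isomorphic to Z^n. Such a group
    consists of translations, and their vectors are t z for an invertible real
    matrix t ([abelian_cocycle_translations]). Conjugation by theta g permutes
    these vectors through the integral holonomy rho g, and also acts on them
    through the linear part of theta g. So this linear part is t (rho g) t^-1,
    and it preserves the form on the orthogonal complement of xi modulo xi.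

    Arithmetic. By commensurability some power of each translation is a rational
    matrix. A nontrivial rational unipotent matrix u that fixes xi determines the
    line of xi, as the image of (u - 1)^2, so the cusp is rational
    ([rational_cusp]). A rational reflection then moves xi to a multiple of
    (0, 1, 1) ([isotropic_transitive]); this makes Witt cancellation explicit, as
    the orthogonal complement of (0, 1, 1) modulo this vector is f. In the
    corresponding frame the columns of t are rational, because some multiple of
    each of them is, and t (rho g) t^-1 is a rational isometry of f
    ([rational_holonomy]). *)

Set Implicit Arguments.
Unset Strict Implicit.
Unset Printing Implicit Defensive.

Import Order.TTheory GRing.Theory Num.Theory.
Import numFieldNormedType.Exports.

Local Open Scope classical_set_scope.
Local Open Scope ring_scope.

(** * Bilinear forms *)

Definition bil (K : comUnitRingType) (n : nat) (Q : 'M[K]_n)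
    (x y : 'cV[K]_n) : K :=
  (x^T *m Q *m y) 0 0.

Section Bilinear.
Variables (K : comUnitRingType) (n : nat) (Q : 'M[K]_n).
Implicit Types x y z : 'cV[K]_n.

Lemma bilDl x y z : bil Q (x + y) z = bil Q x z + bil Q y z.
Proof. by rewrite /bil linearD /= !mulmxDl mxE. Qed.

Lemma bilDr x y z : bil Q z (x + y) = bil Q z x + bil Q z y.
Proof. by rewrite /bil mulmxDr mxE. Qed.

Lemma bilZl a x y : bil Q (a *: x) y = a * bil Q x y.
Proof. by rewrite /bil linearZ /= -!scalemxAl mxE. Qed.

Lemma bilZr a x y : bil Q x (a *: y) = a * bil Q x y.
Proof. by rewrite /bil -scalemxAr mxE. Qed.

Lemma bilNl x y : bil Q (- x) y = - bil Q x y.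
Proof. by rewrite -scaleN1r bilZl mulN1r. Qed.

Lemma bilNr x y : bil Q x (- y) = - bil Q x y.
Proof. by rewrite -scaleN1r bilZr mulN1r. Qed.

Lemma bil0l y : bil Q 0 y = 0.
Proof. by rewrite -(scale0r 0) bilZl mul0r. Qed.

Lemma bil0r y : bil Q y 0 = 0.
Proof. by rewrite -(scale0r 0) bilZr mul0r. Qed.

Definition bilE := (bilDl, bilDr, bilNl, bilNr, bilZl, bilZr, bil0l, bil0r).

Lemma bilC x y : Q^T = Q -> bil Q x y = bil Q y x.
Proof.
move=> Qs; rewrite /bil -[in LHS](trmxK Q) -[in LHS](trmxK y).
by rewrite -!trmx_mul mxE mulmxA Qs.
Qed.

Lemma bil_orthogonal A x y :
  A^T *m Q *m A = Q -> bil Q (A *m x) (A *m y) = bil Q x y.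
Proof.
by move=> hA; rewrite /bil trmx_mul -[in RHS]hA !mulmxA.
Qed.

Lemma bil_delta i j : bil Q (delta_mx i 0) (delta_mx j 0) = Q i j.
Proof.
by rewrite /bil trmx_delta -rowE -colE !mxE.
Qed.

End Bilinear.

Lemma orthogonal_bil (K : comUnitRingType) n (Q A : 'M[K]_n) :
  (forall x y, bil Q (A *m x) (A *m y) = bil Q x y) -> A^T *m Q *m A = Q.
Proof.
move=> h; apply/matrixP => i j; rewrite -!bil_delta -h.
by rewrite /bil trmx_mul !mulmxA.
Qed.

Lemma bil_osum (K : comUnitRingType) m n (Q1 : 'M[K]_m) (Q2 : 'M[K]_n) a b c d :
  bil (osum Q1 Q2) (col_mx a b) (col_mx c d) = bil Q1 a c + bil Q2 b d.
Proof.
rewrite /bil /osum tr_col_mx mul_row_block !mulmx0 addr0 add0r mul_row_col.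
by rewrite mxE.
Qed.

Lemma bil_form1 (K : comUnitRingType) (a : K) x y :
  bil (form1 a) x y = a * (x 0 0 * y 0 0).
Proof.
rewrite /bil /form1 mul_mx_scalar -scalemxAl mxE; congr (_ * _).
by rewrite mxE big_ord_recl big_ord0 addr0 mxE.
Qed.

Lemma bil_to_real (R : realType) n (Q : 'M[rat]_n) x y :
  bil (to_real R Q) (to_real R x) (to_real R y) = ratr (bil Q x y).
Proof. by rewrite /bil /to_real matrix.map_trmx -!map_mxM mxE. Qed.

(** * Positive definite forms over the reals *)

Definition posdef (R : realFieldType) n (Q : 'M[R]_n) :=
  forall v, v != 0 -> 0 < bil Q v v.

Lemma cauchy_schwarz (R : realFieldType) n (Q : 'M[R]_n) x y :
  Q^T = Q -> posdef Q -> bil Q x y ^+ 2 <= bil Q x x * bil Q y y.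
Proof.
move=> Qs Qp; have [->|y0] := eqVneq y 0; first by rewrite !bilE expr0n mulr0.
have qy := Qp _ y0.
have : 0 <= bil Q (bil Q y y *: x - bil Q x y *: y) (bil Q y y *: x - bil Q x y *: y).
  by set z := _ - _; have [->|/Qp/ltW//] := eqVneq z 0; rewrite bil0l.
rewrite !bilE (bilC y x Qs).
set a := bil Q y y; set b := bil Q x y; set c := bil Q x x => h.
have : 0 <= a * (c * a - b ^+ 2) by move: h; congr (_ <= _); ring.
by rewrite pmulr_rge0 // subr_ge0.
Qed.

Lemma coord_sqr_le (R : realFieldType) n (Q : 'M[R]_n) (v : 'cV[R]_n) j :
  Q^T = Q -> Q \in unitmx -> posdef Q ->
  v j 0 ^+ 2 <= invmx Q j j * bil Q v v.
Proof.
move=> Qs Qu Qp.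
have e1 w : bil Q (invmx Q *m delta_mx j 0) w = w j 0.
  rewrite /bil trmx_mul trmx_inv Qs -(mulmxA _ (invmx Q)) mulVmx // mulmx1.
  by rewrite trmx_delta -rowE mxE.
have -> : invmx Q j j = bil Q (invmx Q *m delta_mx j 0) (invmx Q *m delta_mx j 0).
  by rewrite e1 -colE mxE.
by rewrite -{1}(e1 v); apply: cauchy_schwarz.
Qed.

(** Completing the square in the first variable: this preserves positivity of
    a rational form and is compatible with extension of scalars. *)
Lemma posdef_real (R : realType) n (f : 'M[rat]_n) :
  f^T = f -> positive_definite f -> posdef (to_real R f).
Proof.
elim: n f => [|n IH] f fs fp v v0.
  by move: v0; rewrite flatmx0 eqxx.
rewrite -[n.+1]/(1 + n)%N in f fs fp v v0 *.
pose a := ulsubmx f 0 0; pose b := ursubmx f; pose d := drsubmx f.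
have fE : f = block_mx a%:M b b^T d.
  rewrite -[f in LHS]submxK /b /d; congr block_mx; first by rewrite [LHS]mx11_scalar.
  by rewrite trmx_ursub fs.
have ds : d^T = d by rewrite /d trmx_drsub fs.
have e0 : (col_mx 1%:M 0 : 'cV[rat]_(1 + n)) != 0.
  by apply/eqP => /matrixP /(_ (lshift n 0) 0)/eqP; rewrite col_mxEu !mxE oner_eq0.
have qE (K : fieldType) (al : K) (be : 'rV[K]_n) de x (w : 'cV[K]_n) :
   bil (block_mx al%:M be be^T de) (col_mx x%:M w) (col_mx x%:M w) =
   al * x ^+ 2 + 2 * x * (be *m w) 0 0 + bil de w w.
  have e1 : (w^T *m be^T) 0 0 = (be *m w) 0 0 by rewrite -trmx_mul mxE.
  rewrite /bil tr_col_mx tr_scalar_mx mul_row_block mul_row_col !mulmxDl.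
  rewrite !mul_scalar_mx -!scalemxAl !mul_mx_scalar -[al%:M]scalemx1 !scalerA.
  by rewrite !mxE; rewrite !mxE in e1; rewrite e1 eqxx mulr1n; ring.
have sE (K : fieldType) (al : K) (be : 'rV[K]_n) de (w : 'cV[K]_n) :
   bil (de - al^-1 *: (be^T *m be)) w w = bil de w w - al^-1 * ((be *m w) 0 0) ^+ 2.
  rewrite /bil mulmxBr mulmxBl -scalemxAr -scalemxAl !mulmxA -trmx_mul -(mulmxA _ be).
  rewrite [X in _ - _ *: X]mx11_scalar !mxE big_ord_recl big_ord0 addr0 !mxE eqxx mulr1n.
  by rewrite -expr2.
have a0 : 0 < a.
  have := fp _ e0; rewrite /form_value -[X in 0 < X]/(bil _ _ _) fE qE.
  by rewrite mulmx0 /bil mulmx0 !mxE expr1n mulr0 !addr0 mulr1.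
pose s := d - a^-1 *: (b^T *m b).
have ss : s^T = s by rewrite /s linearB linearZ /= trmx_mul trmxK ds.
have sp : positive_definite s.
  move=> w w0; pose x := - a^-1 * (b *m w) 0 0.
  have : col_mx x%:M w != 0.
    by apply: contra_neq w0 => /(congr1 (@dsubmx _ _ _ _)); rewrite col_mxKd linear0.
  move/fp; rewrite /form_value -![X in 0 < X -> _]/(bil _ _ _) fE qE.
  rewrite -[X in _ -> 0 < X]/(bil _ _ _) sE /x.
  by congr (0 < _); field; rewrite gt_eqF.
have {IH} sR := IH _ ss sp.
have aR : 0 < ratr a :> R by rewrite ltr0q.
have -> : to_real R f = block_mx (ratr a)%:M (to_real R b) (to_real R b)^T (to_real R d).
  by rewrite fE /to_real map_block_mx map_scalar_mx matrix.map_trmx.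
rewrite -[v]vsubmxK in v0 *; rewrite [usubmx v]mx11_scalar in v0 *.
move: (usubmx v 0 0) (dsubmx v) v0 => x w v0.
have sRE : to_real R s = to_real R d - (ratr a)^-1 *: ((to_real R b)^T *m to_real R b).
  by rewrite /to_real /s map_mxB map_mxZ map_mxM matrix.map_trmx fmorphV.
have := sE R (ratr a) (to_real R b) (to_real R d) w; rewrite -sRE qE.
set c := (_ *m w) 0 0; set D := bil (to_real R d) w w => sw.
have -> : ratr a * x ^+ 2 + 2 * x * c + D =
   ratr a * (x + (ratr a)^-1 * c) ^+ 2 + bil (to_real R s) w w.
  by rewrite sw; field; rewrite gt_eqF.
have [w0|/sR sw0] := eqVneq w 0; last first.
  by rewrite ltr_wpDl // mulr_ge0 ?sqr_ge0 // ltW.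
have x0 : x != 0.
  apply: contra_neq v0 => ->; rewrite w0.
  by rewrite (_ : 0%:M = 0) ?col_mx0 // -scalemx1 scale0r.
rewrite /c w0 mulmx0 mxE mulr0 addr0 bil0l addr0.
by rewrite mulr_gt0 // exprn_even_gt0.
Qed.

Lemma orthogonalM (K : comUnitRingType) n (Q A B : 'M[K]_n) :
  A^T *m Q *m A = Q -> B^T *m Q *m B = Q -> (A *m B)^T *m Q *m (A *m B) = Q.
Proof.
move=> hA hB; apply: orthogonal_bil => x y.
by rewrite -!mulmxA !bil_orthogonal.
Qed.

Lemma orthogonal_unit (K : fieldType) n (Q A : 'M[K]_n) :
  Q \in unitmx -> A^T *m Q *m A = Q -> A \in unitmx.
Proof.
by move=> Qu hA; move: Qu; rewrite -hA unitmx_mul => /andP[].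
Qed.

(** * The form f + <1> + <-1> near an isotropic line *)

Section Standard.
Variables (K : realFieldType) (n : nat) (f : 'M[K]_n).
Hypothesis fs : f^T = f.

(** The ordered field K is the reals in the geometric part, and the rationals in
    the choice of a rational frame for the cusp. *)
Definition qform : 'M[K]_(n + 1 + 1) :=
  osum (osum f (form1 1)) (form1 (-1)).

Definition xi0 : 'cV[K]_(n + 1 + 1) := col_mx (col_mx 0 1%:M) 1%:M.

(** The isotropic vector dual to xi0: their pairing is -1, and both are
    orthogonal to the summand f. *)
Definition eta0 : 'cV[K]_(n + 1 + 1) :=
  col_mx (col_mx 0 (- 2^-1)%:M) (2^-1)%:M.

Definition flat_incl (e : 'cV[K]_n) : 'cV[K]_(n + 1 + 1) :=
  col_mx (col_mx e 0) 0.

Definition flat_proj (x : 'cV[K]_(n + 1 + 1)) : 'cV[K]_n := usubmx (usubmx x).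

Lemma qform_sym : qform^T = qform.
Proof.
by rewrite /qform /osum /form1 !tr_block_mx !trmx0 !tr_scalar_mx fs.
Qed.

Let bilq := (@bil_osum, @bil_form1).

Lemma bil_xi0_xi0 : bil qform xi0 xi0 = 0.
Proof. by rewrite !bilq bil0l !mxE !eqxx /= ?mulr1n; ring. Qed.

Lemma bil_eta0_eta0 : bil qform eta0 eta0 = 0.
Proof. by rewrite !bilq bil0l !mxE !eqxx /= ?mulr1n; ring. Qed.

Lemma bil_xi0_eta0 : bil qform xi0 eta0 = -1.
Proof. by rewrite !bilq bil0l !mxE !eqxx /= ?mulr1n; field. Qed.

Lemma bil_flat_xi0 e : bil qform (flat_incl e) xi0 = 0.
Proof. by rewrite !bilq bil0r !mxE; ring. Qed.

Lemma bil_flat_eta0 e : bil qform (flat_incl e) eta0 = 0.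
Proof. by rewrite !bilq bil0r !mxE; ring. Qed.

Lemma bil_flat e e' : bil qform (flat_incl e) (flat_incl e') = bil f e e'.
Proof. by rewrite !bilq !mxE; ring. Qed.

Lemma flat_projD x y : flat_proj (x + y) = flat_proj x + flat_proj y.
Proof. by rewrite /flat_proj !linearD. Qed.

Lemma flat_projZ a x : flat_proj (a *: x) = a *: flat_proj x.
Proof. by rewrite /flat_proj !linearZ. Qed.

Lemma flat_projB x y : flat_proj (x - y) = flat_proj x - flat_proj y.
Proof. by rewrite /flat_proj !linearB. Qed.

Lemma flat_proj_xi0 : flat_proj xi0 = 0.
Proof. by rewrite /flat_proj !col_mxKu. Qed.

Lemma flat_decomposition x :
  x = - bil qform x eta0 *: xi0 - bil qform x xi0 *: eta0
      + flat_incl (flat_proj x).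
Proof.
have -> : x = col_mx (col_mx (flat_proj x) (dsubmx (usubmx x) 0 0)%:M)
               (dsubmx x 0 0)%:M.
  by rewrite -!mx11_scalar !vsubmxK.
move: (flat_proj x) (dsubmx (usubmx x) 0 0) (dsubmx x 0 0) => e a b.
rewrite !bilq !bil0r /flat_incl /xi0 /eta0 /flat_proj !col_mxKu.
rewrite -scaleNr !scale_col_mx !add_col_mx !scaler0 !add0r.
by congr (col_mx (col_mx _ _) _); apply/matrixP => i j;
  rewrite !ord1 !mxE !eqxx /= !mulr1n; field.
Qed.

Lemma bil_decomposition x y :
  bil qform x y = bil f (flat_proj x) (flat_proj y)
   - bil qform x eta0 * bil qform y xi0 - bil qform x xi0 * bil qform y eta0.
Proof.
rewrite {1}(flat_decomposition y) !bilE (bilC x (flat_incl _) qform_sym).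
rewrite {3}(flat_decomposition x) !bilE bil_flat.
rewrite bil_flat_xi0 bil_flat_eta0.
rewrite (bilC _ (flat_proj y) fs); ring.
Qed.

(** On the orthogonal complement of xi0 the form is f, pulled back from the
    quotient by xi0. *)
Lemma isotropic_collinear x : posdef f ->
  bil qform x x = 0 -> bil qform x xi0 = 0 -> x = - bil qform x eta0 *: xi0.
Proof.
move=> fp qx bx; have := bil_decomposition x x.
rewrite qx bx mul0r mulr0 !subr0 => /esym e0.
have p0 : flat_proj x = 0.
  by apply: contraTeq isT => /fp; rewrite e0 ltxx.
rewrite {1}(flat_decomposition x) p0 bx scale0r subr0 /flat_incl !col_mx0.
by rewrite addr0.
Qed.

(** ** The parabolic subgroup fixing xi0 *)

Definition cusp_stabilizer (g : 'M[K]_(n + 1 + 1)) :=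
  g^T *m qform *m g = qform /\ g *m xi0 = xi0.

(** An isometry fixing xi0 acts on the quotient of the orthogonal complement of
    xi0 by xi0, which is the space of f, through [lin_part]; it acts on each
    horosphere, identified with this space by [flat_proj], by an affine map whose
    translation vector is proportional to [trans_part]. *)
Definition lin_part (g : 'M[K]_(n + 1 + 1)) : 'M[K]_n := ulsubmx (ulsubmx g).

Definition trans_part (g : 'M[K]_(n + 1 + 1)) : 'cV[K]_n :=
  flat_proj (g *m eta0).

Lemma lin_partE g e : flat_proj (g *m flat_incl e) = lin_part g *m e.
Proof.
rewrite /flat_proj /flat_incl /lin_part -{1}(submxK g) mul_block_col mulmx0.
rewrite col_mxKu addr0 -{1}(submxK (ulsubmx g)) mul_block_col mulmx0.
by rewrite col_mxKu addr0.
Qed.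

Lemma cusp_stabilizer_bil g x : cusp_stabilizer g ->
  bil qform (g *m x) xi0 = bil qform x xi0.
Proof. by move=> [gq gx]; rewrite -{1}gx bil_orthogonal. Qed.

Lemma cusp_stabilizer_act g x : cusp_stabilizer g ->
  flat_proj (g *m x) = lin_part g *m flat_proj x - bil qform x xi0 *: trans_part g.
Proof.
move=> [gq gx]; rewrite {1}(flat_decomposition x) !mulmxDr mulmxN -!scalemxAr gx.
rewrite flat_projD flat_projB !flat_projZ lin_partE flat_proj_xi0 scaler0 sub0r.
by rewrite addrC.
Qed.

Lemma mulmx_inj_col m (A B : 'M[K]_(m, n)) :
  (forall e : 'cV_n, A *m e = B *m e) -> A = B.
Proof.
move=> h; apply/matrixP => i j; have /matrixP /(_ i 0) := h (delta_mx j 0).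
by rewrite -!colE !mxE.
Qed.

Lemma lin_partM g h : cusp_stabilizer g -> cusp_stabilizer h ->
  lin_part (g *m h) = lin_part g *m lin_part h.
Proof.
move=> hg hh; apply: mulmx_inj_col => e.
rewrite -lin_partE -mulmxA cusp_stabilizer_act // cusp_stabilizer_bil //.
by rewrite bil_flat_xi0 scale0r subr0 lin_partE mulmxA.
Qed.

Lemma trans_partM g h : cusp_stabilizer g -> cusp_stabilizer h ->
  trans_part (g *m h) = lin_part g *m trans_part h + trans_part g.
Proof.
move=> hg hh; rewrite {1}/trans_part -mulmxA cusp_stabilizer_act //.
rewrite cusp_stabilizer_bil // (bilC _ _ qform_sym) bil_xi0_eta0 scaleN1r.
by rewrite opprK.
Qed.

Lemma lin_part_orthogonal g : cusp_stabilizer g ->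
  (lin_part g)^T *m f *m lin_part g = f.
Proof.
move=> gS; apply: orthogonal_bil => x y.
rewrite -!lin_partE -[RHS]bil_flat -[RHS](bil_orthogonal _ _ (proj1 gS)).
rewrite [RHS]bil_decomposition.
by rewrite !cusp_stabilizer_bil // !bil_flat_xi0 mul0r mulr0 !subr0.
Qed.

(** A unipotent g lowers by one step the filtration of the whole space by the
    orthogonal complement of xi0 and the line of xi0. *)
Lemma unipotent_square g x : cusp_stabilizer g -> lin_part g = 1%:M ->
  exists c, (g - 1%:M) *m (g - 1%:M) *m x = c *: xi0.
Proof.
move=> gS g1; pose y := (g - 1%:M) *m x; pose z := (g - 1%:M) *m y.
have bD w : bil qform ((g - 1%:M) *m w) xi0 = 0.
  by rewrite mulmxBl mul1mx !bilE cusp_stabilizer_bil // subrr.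
exists (- bil qform z eta0); rewrite -mulmxA -/y -/z.
rewrite {1}(flat_decomposition z) bD scale0r subr0.
have -> : flat_proj z = 0.
  rewrite /z mulmxBl mul1mx flat_projB cusp_stabilizer_act // bD scale0r g1.
  by rewrite subr0 mul1mx subrr.
by rewrite /flat_incl !col_mx0 addr0.
Qed.

Lemma unipotent_square_eta0 g : cusp_stabilizer g -> lin_part g = 1%:M ->
  bil qform ((g - 1%:M) *m (g - 1%:M) *m eta0) eta0
    = - bil f (trans_part g) (trans_part g).
Proof.
move=> gS g1; set u := trans_part g.
have pe : flat_proj (g *m eta0) = u by [].
have ge : bil qform (g *m eta0) xi0 = -1.
  by rewrite cusp_stabilizer_bil // (bilC _ _ qform_sym) bil_xi0_eta0.
rewrite -mulmxA [X in _ *m X]mulmxBl mul1mx mulmxBl mul1mx mulmxBr.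
(* the pairing of g eta0 with g^2 eta0 equals that of eta0 with g eta0 *)
have := bil_orthogonal (g *m eta0) eta0 (proj1 gS).
rewrite bil_decomposition !cusp_stabilizer_bil // (bilC eta0 _ qform_sym).
rewrite bil_xi0_eta0 cusp_stabilizer_act // pe ge scaleN1r opprK g1 mul1mx.
have := bil_orthogonal eta0 eta0 (proj1 gS).
rewrite bil_eta0_eta0 bil_decomposition pe ge => h1 h2.
rewrite !bilE bil_eta0_eta0; rewrite !bilE in h2; lra.
Qed.

End Standard.

(** Witt's theorem for isotropic lines: the reflection in xi - xi0 exchanges xi0
    and xi, unless xi is orthogonal, hence proportional, to xi0. The
    reflection is defined over K, so a rational isotropic line is reached by a
    rational isometry. *)
Lemma isotropic_transitive (K : realFieldType) n (f : 'M[K]_n) xi :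
  f^T = f -> posdef f -> xi != 0 -> bil (qform f) xi xi = 0 ->
  exists (S : 'M[K]_(n + 1 + 1)) c,
    [/\ S^T *m qform f *m S = qform f, c != 0 & S *m xi0 K n = c *: xi].
Proof.
move=> fs fp x0 qx; have qs := qform_sym fs; set Q := qform f in qx qs *.
have [bx|bx] := eqVneq (bil Q xi (xi0 K n)) 0.
  have := isotropic_collinear fs fp qx bx.
  move: (- bil _ _ _) => a e.
  have a0 : a != 0 by apply: contra_neq x0 => a0; rewrite e a0 scale0r.
  exists 1%:M, a^-1; split; rewrite ?invr_eq0 //.
  - by rewrite trmx1 mul1mx mulmx1.
  - by rewrite mul1mx e scalerA mulVf ?scale1r.
set v := xi - xi0 K n; set r := bil Q xi (xi0 K n) in bx.
have qv : bil Q v v = - 2 * r.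
  by rewrite !bilE qx bil_xi0_xi0 (bilC (xi0 _ _) _ qs) -/r; ring.
pose S := 1%:M + r^-1 *: (v *m (v^T *m Q)).
have SE x : S *m x = x + (r^-1 * bil Q v x) *: v.
  rewrite /S mulmxDl mul1mx -scalemxAl -mulmxA [X in v *m X]mx11_scalar.
  by rewrite mul_mx_scalar scalerA.
have vx : bil Q v (xi0 K n) = r by rewrite bilDl bilNl bil_xi0_xi0 subr0.
have vE : xi = xi0 K n + v by rewrite addrC subrK.
clearbody v r S; exists S, 1; split; rewrite ?oner_eq0 //.
- apply: orthogonal_bil => x y; rewrite !SE !bilE qv (bilC x v qs).
  by field.
- by rewrite SE vx mulVf // !scale1r.
Qed.

(** * Discrete groups of isometries of a Lorentzian form *)

Section LorentzBound.
Variables (R : realFieldType) (m : nat) (p : 'M[R]_m).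
Hypotheses (ps : p^T = p) (pu : p \in unitmx) (pp : posdef p).

Let Q := osum p (form1 (-1)).
Let ht (x : 'cV[R]_(m + 1)) : R := dsubmx x 0 0.

Lemma lorentz_bil x y :
  bil Q x y = bil p (usubmx x) (usubmx y) - ht x * ht y.
Proof.
by rewrite -{1}(vsubmxK x) -{1}(vsubmxK y) bil_osum bil_form1 mulN1r.
Qed.

(** The Cauchy-Schwarz inequality for the positive definite part. *)
Lemma lorentz_cauchy_schwarz x y :
  (bil Q x y + ht x * ht y) ^+ 2 <=
  (bil Q x x + ht x ^+ 2) * (bil Q y y + ht y ^+ 2).
Proof. by rewrite !lorentz_bil !expr2 !subrK; apply: cauchy_schwarz. Qed.

Let e : 'cV[R]_(m + 1) := col_mx 0 1%:M.

Lemma lorentz_bil_base x : bil Q e x = - ht x.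
Proof.
by rewrite lorentz_bil /e /ht col_mxKu col_mxKd bil0l mxE mul1r sub0r.
Qed.

Lemma coord_bound (x : 'cV[R]_(m + 1)) i :
  x i 0 ^+ 2 <= (1 + \sum_j `|invmx p j j|) * (`|bil Q x x| + ht x ^+ 2).
Proof.
set s := \sum_j _; have s0 : 0 <= s by apply: sumr_ge0.
have n0 := normr_ge0 (bil Q x x); have h0 := sqr_ge0 (ht x).
rewrite -{1}(vsubmxK x); case: (split_ordP i) => k ->; last first.
  by rewrite col_mxEd ord1 -/(ht x); nra.
rewrite col_mxEu; apply: (le_trans (coord_sqr_le _ _ ps pu pp)).
have -> : bil p (usubmx x) (usubmx x) = bil Q x x + ht x ^+ 2.
  by rewrite lorentz_bil expr2 subrK.
have le1 : invmx p k k <= 1 + s.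
  rewrite ler_wpDl // (le_trans (ler_norm _)) // /s (bigD1 k) //= lerDl.
  exact: sumr_ge0.
have q0 : 0 <= bil Q x x + ht x ^+ 2.
  rewrite lorentz_bil expr2 subrK.
  by have [->|/pp/ltW//] := eqVneq (usubmx x) 0; rewrite bil0l.
apply: (le_trans (ler_wpM2r q0 le1)); apply: ler_wpM2l; first by rewrite addr_ge0.
by rewrite lerD2r ler_norm.
Qed.

(** In hyperbolic terms this is the triangle inequality: the distance by which g
    moves the base point e is controlled by the distances of z and of g z from
    it. It comes from Cauchy-Schwarz for g z and g e. *)
Lemma corner_bound g z (k : R) :
  g^T *m Q *m g = Q -> bil Q z z = -1 -> `|ht z| <= k -> `|ht (g *m z)| <= k ->
  ht (g *m e) ^+ 2 <= 4 * k ^+ 4.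
Proof.
move=> gQ qz hz hz'; set d := ht _.
have k0 : 0 <= k by apply: le_trans hz.
have qe : bil Q e e = -1 by rewrite lorentz_bil_base /ht col_mxKd mxE.
have := lorentz_cauchy_schwarz (g *m z) (g *m e).
rewrite !bil_orthogonal // qz qe (bilC z) ?lorentz_bil_base; last first.
  by rewrite /Q /osum /form1 tr_block_mx !trmx0 tr_scalar_mx ps.
have z1 : 1 <= ht z ^+ 2.
  move: (lorentz_bil z z); rewrite qz -expr2.
  have : 0 <= bil p (usubmx z) (usubmx z).
    by have [->|/pp/ltW//] := eqVneq (usubmx z) 0; rewrite bil0l.
  lra.
rewrite -/d; move: (ht z) (ht (g *m z)) hz hz' z1 => a b ha hb a1 h.
have h1 : d ^+ 2 <= 2 * a * b * d by nra.
have ab : `|a * b| <= k ^+ 2 by rewrite normrM expr2 ler_pM.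
have h2 : `|d| ^+ 2 <= 2 * k ^+ 2 * `|d|.
  rewrite real_normK ?num_real // (le_trans h1) // (le_trans (ler_norm _)) //.
  rewrite -!mulrA (mulrA a) !normrM -(normrM a) (ger0_norm (ler0n _ 2)).
  by rewrite ler_pM2l // (mulrA k) -expr2 ler_wpM2r.
have h3 : `|d| <= 2 * k ^+ 2.
  have [->|d0] := eqVneq d 0; first by rewrite normr0; nra.
  by move: h2; rewrite expr2 ler_pM2r // normr_gt0.
rewrite -real_normK ?num_real // (_ : 4 * k ^+ 4 = (2 * k ^+ 2) ^+ 2); last by ring.
by rewrite ler_sqr ?nnegrE //; nra.
Qed.

(** Cauchy-Schwarz for g x and g e, whose pairing is that of x and e. *)
Lemma image_height_bound g x (d2 : R) :
  g^T *m Q *m g = Q -> ht (g *m e) ^+ 2 <= d2 ->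
  ht (g *m x) ^+ 2 <= 4 * d2 * ht x ^+ 2 + 2 * `|bil Q x x| * (d2 + 1).
Proof.
move=> gQ hd; have qe : bil Q e e = -1 by rewrite lorentz_bil_base /ht col_mxKd mxE.
have := lorentz_cauchy_schwarz (g *m x) (g *m e).
rewrite !bil_orthogonal // qe (bilC x) ?lorentz_bil_base; last first.
  by rewrite /Q /osum /form1 tr_block_mx !trmx0 tr_scalar_mx ps.
have := ler_norm (bil Q x x); have := ler_norm (- bil Q x x); rewrite normrN.
move: (bil Q x x) (ht (g *m x)) (ht x) (ht (g *m e)) hd => q c h d hd q1 q2 cs.
have q0 : 0 <= `|q| by [].
have e1 : c ^+ 2 <= 2 * (c * d * h) + q * d ^+ 2 - q - h ^+ 2 by nra.
have e2 : 2 * (c * d * h) <= c ^+ 2 / 2 + 2 * (d * h) ^+ 2.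
  have := sqr_ge0 (c / 2 - d * h); nra.
have e3 : q * d ^+ 2 <= `|q| * d2.
  apply: (le_trans (ler_wpM2r (sqr_ge0 d) q2)); exact: ler_wpM2l.
have e4 : (d * h) ^+ 2 <= d2 * h ^+ 2.
  by rewrite exprMn ler_wpM2r // sqr_ge0.
have := sqr_ge0 h; lra.
Qed.

(** The action on the hyperboloid is proper. *)
Lemma isometry_bound (k : R) : exists c : R, forall g z,
  g^T *m Q *m g = Q -> bil Q z z = -1 -> `|ht z| <= k -> `|ht (g *m z)| <= k ->
  forall i j, `|g i j| <= c.
Proof.
pose s : R := 1 + \sum_j `|invmx p j j|.
pose b (x : 'cV[R]_(m + 1)) := 4 * (4 * k ^+ 4) * ht x ^+ 2
  + 2 * `|bil Q x x| * (4 * k ^+ 4 + 1).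
pose c j : R := s * (`|bil Q (delta_mx j 0) (delta_mx j 0)| + b (delta_mx j 0)).
have s0 : 0 <= s by rewrite addr_ge0 // sumr_ge0.
have c0 j : 0 <= c j.
  have k4 : 0 <= k ^+ 4 by apply: exprn_even_ge0.
  apply: mulr_ge0 => //; apply: addr_ge0 => //; apply: addr_ge0.
    by rewrite mulr_ge0 ?sqr_ge0 //; lra.
  by rewrite !mulr_ge0 //; lra.
exists (1 + \sum_j c j) => g z gQ qz hz hz' i j.
have -> : g i j = (g *m (delta_mx j 0 : 'cV[R]_(m + 1))) i 0 by rewrite -colE mxE.
have hj : c j <= \sum_j c j.
  by rewrite (bigD1 j) //= lerDl sumr_ge0.
have : (g *m (delta_mx j 0 : 'cV[R]_(m + 1))) i 0 ^+ 2 <= c j.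
  apply: (le_trans (coord_bound _ _)); rewrite bil_orthogonal // ler_wpM2l //.
  rewrite lerD2l; apply: image_height_bound => //.
  exact: corner_bound hz hz'.
move: (_ i 0) => y; rewrite -real_normK ?num_real //.
have := normr_ge0 y; move: `|y| => t t0 h1; have := le_trans h1 hj; nra.
Qed.

End LorentzBound.

Lemma finite_set_of_inj (T : choiceType) (U : Type) (A : set T) (h : T -> U)
    (D : set U) :
  finite_set D -> (forall x, A x -> D (h x)) ->
  (forall x y, A x -> A y -> h x = h y -> x = y) -> finite_set A.
Proof.
move=> Df hD hinj.
have [[x0 _]|A0] := pselect (exists x, A x); last first.
  by rewrite (_ : A = set0) //; apply/seteqP; split=> // x Ax; case: A0; exists x.
apply: (@sub_finite_set _ _ [set xget x0 [set x | A x /\ h x = u] | u in D]).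
  move=> x Ax /=; exists (h x); first exact: hD.
  by case: xgetP => [y _ [Ay /hinj->]//|/(_ x)]; case.
exact: finite_image.
Qed.

Lemma finite_int_box (a b : nat) (N : nat) :
  finite_set [set M : 'M[int]_(a, b) | forall i j, `|M i j| <= N%:Z].
Proof.
pose dec (M : 'M['I_(N + N).+1]_(a, b)) : 'M[int]_(a, b) :=
  \matrix_(i, j) ((M i j : nat)%:Z - N%:Z).
apply: (@sub_finite_set _ _ [set dec M | M in setT]); last first.
  exact/finite_image/finite_finset.
move=> M /= hM; exists (\matrix_(i, j) inord (absz (M i j + N%:Z))) => //.
apply/matrixP => i j; rewrite !mxE.
have := hM i j; rewrite ler_norml => /andP[h1 h2].
have h3 : 0 <= M i j + N%:Z by rewrite -lerBlDr sub0r.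
rewrite inordK; first by rewrite gez0_abs // addrK.
by rewrite ltnS -lez_nat gez0_abs // PoszD lerD2r.
Qed.

(** Two elements of B whose entries lie in the same cell of a fine grid differ by
    an element close to 1, because the inverses are bounded as well; hence they
    are equal, and only finitely many cells meet a bounded region. *)
Lemma discrete_bounded_finite (R : realType) n (G B : set 'M[R]_n) (k : R) :
  matrix_group G -> isolated G 1%:M -> B `<=` G ->
  (forall g, B g -> B (invmx g)) ->
  (forall g, B g -> forall i j, `|g i j| <= k) -> finite_set B.
Proof.
move=> [G1 GM GV] [_ [V /nbhs_ballP[e /= e0 eV] VG]] BG BV Bk.
have G_isol g : G g -> (forall i j, `|(1%:M : 'M[R]_n) i j - g i j| < e) -> g = 1%:M.
  move=> Gg ge; have : (V `&` G) g by split=> //; apply: eV; split.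
  by rewrite VG.
pose d := e / (n%:R * `|k| + 1).
have nk : 0 < n%:R * `|k| + 1 by rewrite ltr_wpDl // mulr_ge0.
have d0 : 0 < d by rewrite divr_gt0.
have dE : d * (n%:R * `|k| + 1) = e by rewrite divfK // gt_eqF.
clearbody d.
pose h (g : 'M[R]_n) : 'M[int]_n := \matrix_(i, j) Num.floor (g i j / d).
pose N := (Num.truncn (k / d)).+2.
apply: (@finite_set_of_inj _ _ B h [set M | forall i j, `|M i j| <= N%:Z]).
- exact: finite_int_box.
- move=> g /Bk gk i j; rewrite mxE.
  have := gk i j; rewrite ler_norml => /andP[h1 h2].
  have := floor_itv (g i j / d); set a := Num.floor _ => /andP[a1 a2].
  have t1 : k / d < (Num.truncn (k / d)).+1%:R by apply: truncnS_gt.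
  have k1 : g i j / d <= k / d by rewrite ler_pM2r // invr_gt0.
  have k2 : - (k / d) <= g i j / d by rewrite -mulNr ler_pM2r // invr_gt0.
  have NE : (N%:Z)%:~R = (Num.truncn (k / d)).+1%:R + 1 :> R.
    by rewrite -pmulrn natr1.
  rewrite ler_norml -!(ler_int R) rmorphN /= NE.
  move: a2; rewrite intrD /= => a2; apply/andP; split; lra.
- move=> g g' Bg Bg' hE; have [gu Gg'] := GV _ (BG _ Bg).
  have gg' : invmx g *m g' = 1%:M.
    apply: G_isol => [|i j]; first exact/GM/BG.
    have -> : (1%:M : 'M[R]_n) i j - (invmx g *m g') i j = (invmx g *m (g - g')) i j.
      by rewrite mulmxBr mulVmx // !mxE.
    rewrite mxE; apply: (@le_lt_trans _ _ (\sum_(l < n) (`|k| * d))).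
      apply: (le_trans (ler_norm_sum _ _ _)); apply: ler_sum => l _.
      rewrite normrM; apply: ler_pM => //.
        by apply: (le_trans (Bk _ (BV _ Bg) _ _)); apply: ler_norm.
      rewrite !mxE; move/matrixP/(_ l j): hE; rewrite !mxE => hE.
      have /andP[] := floor_itv (g l j / d); have /andP[] := floor_itv (g' l j / d).
      rewrite -hE; set a := Num.floor _; rewrite intrD /= !ler_pdivlMr // !ltr_pdivrMr //.
      by move=> *; rewrite ler_norml; apply/andP; split; lra.
    by rewrite sumr_const card_ord -mulr_natl -dE; lra.
  by rewrite -[LHS]mulmx1 -gg' mulKVmx.
Qed.

(** * Lifting maps from convex sets to quotients *)

Lemma fin_lower_bound (R : realFieldType) (I : finType) (g : I -> R) :
  (forall i, 0 < g i) -> exists2 d, 0 < d & forall i, d <= g i.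
Proof.
move=> g0; have s0 i : 0 <= \sum_(j | j != i) (g j)^-1.
  by apply: sumr_ge0 => j _; rewrite invr_ge0 ltW.
have t0 : 0 < 1 + \sum_j (g j)^-1.
  by rewrite ltr_pwDl // sumr_ge0 // => j _; rewrite invr_ge0 ltW.
(* a lower bound that makes sense for an empty index type *)
exists (1 + \sum_j (g j)^-1)^-1; first by rewrite invr_gt0.
move=> i; rewrite -[leRHS]invrK lef_pV2 ?posrE ?invr_gt0 //.
by rewrite (bigD1 i) //= addrCA lerDl addr_ge0.
Qed.

Section Balls.
Variables (R : realType) (a : nat).
Implicit Types (x y z : 'cV[R]_a) (d e s t : R).

Lemma colballP x e y :
  ball x e y <-> 0 < e /\ forall i, `|x i 0 - y i 0| < e.
Proof.
split=> [[e0 h]|[e0 h]]; split=> // i; first exact: h.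
by move=> j; rewrite ord1; apply: h.
Qed.

Lemma colball_open x e y : ball x e y ->
  exists2 d, 0 < d & forall z, ball y d z -> ball x e z.
Proof.
move=> /colballP[e0 h].
have [|d d0 dh] := @fin_lower_bound _ _ (fun i => e - `|x i 0 - y i 0|).
  by move=> i; rewrite subr_gt0.
exists d => // z /colballP[_ yz]; apply/colballP; split=> // i.
apply: (le_lt_trans (ler_distD (y i 0) _ _)).
by have := dh i; have := yz i; lra.
Qed.

Lemma colball_le x e e' y : e <= e' -> ball x e y -> ball x e' y.
Proof. by move=> h; apply: le_ball. Qed.

Lemma colball_separated x y : x != y ->
  exists2 e, 0 < e & forall z, ball x e z -> ball y e z -> False.
Proof.
move=> xy; have [i xyi] : exists i, x i 0 != y i 0.
  apply/existsP; rewrite -negb_forall; apply: contra xy => /forallP h.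
  by apply/eqP/matrixP => i j; rewrite ord1; apply/eqP.
have d0 : 0 < `|x i 0 - y i 0| by rewrite normr_gt0 subr_eq0.
exists (`|x i 0 - y i 0| / 2); first by rewrite divr_gt0.
move=> z /colballP[_ /(_ i) h1] /colballP[_ /(_ i) h2].
have := ler_distD (z i 0) (x i 0) (y i 0); rewrite (distrC (z i 0)); lra.
Qed.

Definition seg x y s : 'cV[R]_a := x + s *: (y - x).

Lemma seg0 x y : seg x y 0 = x.
Proof. by rewrite /seg scale0r addr0. Qed.

Lemma seg1 x y : seg x y 1 = y.
Proof. by rewrite /seg scale1r addrC subrK. Qed.

Lemma segxx x s : seg x x s = x.
Proof. by rewrite /seg subrr scaler0 addr0. Qed.

Lemma seg_seg x y s t : seg x (seg x y s) t = seg x y (t * s).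
Proof. by rewrite /seg (addrC x (s *: _)) addrK scalerA. Qed.

Lemma seg_cont x y s d : 0 < d ->
  exists2 d', 0 < d' & forall t, `|s - t| < d' -> ball (seg x y s) d (seg x y t).
Proof.
move=> d0; pose m := 1 + \sum_i `|(y - x) i 0|.
have m0 : 0 < m by rewrite ltr_pwDl // sumr_ge0.
exists (d / m); first by rewrite divr_gt0.
move=> t; rewrite ltr_pdivlMr // => st; apply/colballP; split=> // i.
have -> : seg x y s i 0 - seg x y t i 0 = (s - t) * (y - x) i 0.
  by rewrite /seg !mxE; ring.
rewrite normrM; apply: le_lt_trans st; apply: ler_wpM2l => //.
by rewrite /m (bigD1 i) //= addrCA lerDl addr_ge0 // sumr_ge0.
Qed.

Definition convex_set (C : set 'cV[R]_a) :=
  forall x y s, C x -> C y -> 0 <= s <= 1 -> C (seg x y s).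

Lemma seg_ball x x' e y y' s : 0 <= s <= 1 ->
  ball x e y -> ball x' e y' -> ball (seg x x' s) e (seg y y' s).
Proof.
move=> /andP[s0 s1] /colballP[e0 h] /colballP[_ h']; apply/colballP; split=> // i.
have -> : seg x x' s i 0 - seg y y' s i 0 =
    (1 - s) * (x i 0 - y i 0) + s * (x' i 0 - y' i 0).
  by rewrite /seg !mxE; ring.
apply: (le_lt_trans (ler_normD _ _)); rewrite !normrM.
rewrite (ger0_norm s0) ger0_norm ?subr_ge0 //.
have [->|s'] := eqVneq s 0; first by rewrite subr0 mul1r mul0r addr0.
have : s * `|x' i 0 - y' i 0| < s * e by rewrite ltr_pM2l // lt0r s'.
have : (1 - s) * `|x i 0 - y i 0| <= (1 - s) * e by rewrite ler_wpM2l ?subr_ge0 // ltW.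
lra.
Qed.

Lemma convex_ball x e : convex_set (ball x e).
Proof. by move=> y z s xy xz s01; rewrite -(segxx x s); apply: seg_ball. Qed.

Lemma convex_setI C D : convex_set C -> convex_set D -> convex_set (C `&` D).
Proof. by move=> hC hD x y s [? ?] [? ?] ?; split; [apply: hC|apply: hD]. Qed.

End Balls.

(** Connectedness of [0,1], in the form used to propagate along segments the
    equality or the existence of lifts. *)
Lemma unit_interval_constant (R : realType) (P : R -> Prop) :
  (forall s, 0 <= s <= 1 -> exists2 d, 0 < d &
     forall s1 s2, 0 <= s1 <= 1 -> 0 <= s2 <= 1 ->
       `|s - s1| < d -> `|s - s2| < d -> P s1 -> P s2) ->
  P 0 -> P 1.
Proof.
move=> hP P0.
pose A := [set s : R | 0 <= s <= 1 /\ forall t, 0 <= t <= s -> P t].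
have A0 : A 0.
  split; first by rewrite lexx ler01.
  by move=> t h; have -> : t = 0 by apply/eqP; rewrite eq_le andbC.
have supA : has_sup A.
  by split; [exists 0|exists 1 => s [/andP[]]].
set t := sup A.
have t01 : 0 <= t <= 1.
  apply/andP; split; first exact: ub_le_sup (proj2 supA) _ A0.
  by apply: ge_sup; [exists 0|move=> s [/andP[]]].
have [d d0 hd] := hP t t01.
have [s As ts] := sup_adherent d0 supA.
have st : s <= t by apply: ub_le_sup => //; exact: (proj2 supA).
have [s01 Ps] := As.
have hnear u : 0 <= u <= 1 -> `|t - u| < d -> P u.
  move=> u01 tu; apply: (hd s u) => //.
    by rewrite ger0_norm ?subr_ge0 // -/t in ts *; lra.
  by apply: Ps; rewrite lexx andbT; case/andP: s01.
have [t1|t1] := ltP t 1; last first.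
  apply: hnear; first by rewrite ler01 lexx.
  have -> : t = 1 by apply/eqP; rewrite eq_le t1 andbT; case/andP: t01.
  by rewrite subrr normr0.
pose u := Num.min 1 (t + d / 2).
have tu : t < u by rewrite /u lt_min t1 ltrDl divr_gt0.
have u1 : u <= 1 by rewrite /u ge_min lexx.
have u2 : u <= t + d / 2 by rewrite /u ge_min lexx orbT.
have t0 : 0 <= t by case/andP: t01.
suff Au : A u by have := ub_le_sup (proj2 supA) Au; rewrite -/t leNgt tu.
split; first by apply/andP; split=> //; lra.
move=> v /andP[v0 vu]; have [vs|sv] := leP v s; first by apply: Ps; rewrite v0.
apply: hnear; first by apply/andP; split=> //; lra.
by rewrite -/t in ts; rewrite ltr_norml; apply/andP; split; lra.
Qed.

Definition cont_on (R : realType) a b (C : set 'cV[R]_a)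
    (f : 'cV[R]_a -> 'cV[R]_b) :=
  forall x, C x -> forall e : R, 0 < e ->
    exists2 d : R, 0 < d & forall y, C y -> ball x d y -> ball (f x) e (f y).

Lemma cont_on_sub (R : realType) a b (C D : set 'cV[R]_a)
    (f : 'cV[R]_a -> 'cV[R]_b) :
  D `<=` C -> cont_on C f -> cont_on D f.
Proof.
move=> DC fC x Dx e e0; have [d d0 h] := fC x (DC _ Dx) e e0.
by exists d => // y /DC; apply: h.
Qed.

Lemma cont_on_comp (R : realType) a b c (C : set 'cV[R]_a) (D : set 'cV[R]_b)
    (f : 'cV[R]_a -> 'cV[R]_b) (g : 'cV[R]_b -> 'cV[R]_c) :
  (forall x, C x -> D (f x)) -> cont_on C f -> cont_on D g ->
  cont_on C (g \o f).
Proof.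
move=> CD fC gD x Cx e e0; have [d d0 h] := gD _ (CD _ Cx) e e0.
have [d' d0' h'] := fC x Cx d d0.
by exists d' => // y Cy xy; apply: h; [exact: CD|exact: h'].
Qed.

(** The quotient map [p] is injective near each point of Y; together with deck
    transformations this is what is used of a covering map. *)
Definition locally_separated (R : realType) b T (Y : set 'cV[R]_b)
    (p : 'cV[R]_b -> T) :=
  forall y, Y y -> exists2 e : R, 0 < e & forall z z', Y z -> Y z' ->
    ball y e z -> ball y e z' -> p z = p z' -> z = z'.

Section Lifting.
Variables (R : realType) (a b : nat) (T : Type).
Variables (C : set 'cV[R]_a) (Y : set 'cV[R]_b) (p : 'cV[R]_b -> T).
Hypothesis Cconv : convex_set C.
Hypothesis Ysep : locally_separated Y p.

(** On a segment, two lifts agree on an open set by separation, and on a closed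
    set by continuity. *)
Lemma lift_unique (K : set 'cV[R]_a) (phi psi : 'cV[R]_a -> 'cV[R]_b) x0 x :
  convex_set K -> cont_on K phi -> cont_on K psi ->
  (forall z, K z -> [/\ Y (phi z), Y (psi z) & p (phi z) = p (psi z)]) ->
  K x0 -> K x -> phi x0 = psi x0 -> phi x = psi x.
Proof.
move=> Kc cphi cpsi h K0 Kx e0.
pose P s := phi (seg x0 x s) = psi (seg x0 x s).
suff : P 1 by rewrite /P seg1.
apply: unit_interval_constant => [s s01|]; last by rewrite /P seg0.
pose c := seg x0 x s; have Kc' : K c by apply: Kc.
(* near c the two lifts agree everywhere or nowhere *)
suff [e epos he] : exists2 e : R, 0 < e & (forall z, K z -> ball (phi c) e (phi z) ->
    ball (psi c) e (psi z) -> phi z = psi z) \/ (forall z, K z ->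
    ball (phi c) e (phi z) -> ball (psi c) e (psi z) -> phi z <> psi z).
  have [d1 d10 h1] := cphi c Kc' e epos; have [d2 d20 h2] := cpsi c Kc' e epos.
  have m0 : 0 < Num.min d1 d2 by rewrite lt_min d10.
  have [d d0 hd] := seg_cont x0 x s m0; exists d => // s1 s2 s101 s201 ss1 ss2.
  have near t : 0 <= t <= 1 -> `|s - t| < d ->
      [/\ K (seg x0 x t), ball (phi c) e (phi (seg x0 x t))
        & ball (psi c) e (psi (seg x0 x t))].
    move=> t01 st; have Kt : K (seg x0 x t) by apply: Kc.
    have hb := hd t st; split=> //.
    - by apply: h1 => //; apply: colball_le hb; rewrite ge_min lexx.
    - by apply: h2 => //; apply: colball_le hb; rewrite ge_min lexx orbT.
  have [k1 b1 b1'] := near s1 s101 ss1; have [k2 b2 b2'] := near s2 s201 ss2.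
  rewrite /P => e1; case: he => he; first exact: he.
  by case: (he _ k1 b1 b1').
have [Yc Yc' pc] := h c Kc'.
have [ee|ne] := eqVneq (phi c) (psi c).
  have [e epos he] := Ysep Yc; exists e => //; left=> z Kz; rewrite -ee => b1 b2.
  by have [? ? ?] := h z Kz; apply: he.
have [e epos he] := colball_separated ne; exists e => //; right=> z _ b1 b2 zz.
by apply: (he (phi z)) => //; rewrite zz.
Qed.

Hypothesis Ydeck : forall y y', Y y -> Y y' -> p y = p y' ->
  exists h : 'cV[R]_b -> 'cV[R]_b,
    [/\ h y = y', cont_on Y h & forall z, Y z -> Y (h z) /\ p (h z) = p z].

Variable F : 'cV[R]_a -> T.

Definition is_lift (U : set 'cV[R]_a) (phi : 'cV[R]_a -> 'cV[R]_b) :=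
  cont_on U phi /\ forall x, U x -> Y (phi x) /\ p (phi x) = F x.

Hypothesis Floc : forall x, C x ->
  exists2 d : R, 0 < d & exists phi, is_lift (C `&` ball x d) phi.

Lemma lift_through (U : set 'cV[R]_a) phi x y :
  is_lift U phi -> U x -> Y y -> p y = F x ->
  exists2 psi, is_lift U psi & psi x = y.
Proof.
move=> [cphi hphi] Ux Yy pyF; have [Yx px] := hphi x Ux.
have [|h [hx ch hh]] := Ydeck Yx Yy; first by rewrite px.
exists (h \o phi) => //; split.
  by apply: cont_on_comp ch => // z /hphi[].
move=> z /hphi[Yz pz]; have [? ?] := hh _ Yz; split=> //=; first by rewrite -pz.
Qed.

Lemma lifts_agree (U V : set 'cV[R]_a) phi psi x y :
  convex_set U -> convex_set V -> is_lift U phi -> is_lift V psi ->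
  U x -> V x -> phi x = psi x -> U y -> V y -> phi y = psi y.
Proof.
move=> Uc Vc [c1 h1] [c2 h2] Ux Vx e Uy Vy.
apply: (@lift_unique (U `&` V)) e; try by [].
- exact: convex_setI.
- by apply: cont_on_sub c1 => z [].
- by apply: cont_on_sub c2 => z [].
- by move=> z [/h1[? ?] /h2[? ?]]; split=> //; congruence.
Qed.

Variables (x0 : 'cV[R]_a) (y0 : 'cV[R]_b).
Hypotheses (Cx0 : C x0) (Yy0 : Y y0) (py0 : p y0 = F x0).

(** A convex neighbourhood of the segment from x0 to x. Any two tubes meet in a
    convex set containing x0, so lifts over them agree on the overlap. *)
Definition tube (x : 'cV[R]_a) (e : R) : set 'cV[R]_a :=
  [set z | C z /\ exists2 s : R, 0 <= s <= 1 & ball (seg x0 x s) e z].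

Lemma convex_tube x e : convex_set (tube x e).
Proof.
move=> y z t [Cy [s1 /andP[s10 s11] b1]] [Cz [s2 /andP[s20 s21] b2]] t01.
split; first exact: Cconv.
exists (s1 + t * (s2 - s1)).
  by case/andP: t01 => t0 t1; apply/andP; split; nra.
have -> : seg x0 x (s1 + t * (s2 - s1)) = seg (seg x0 x s1) (seg x0 x s2) t.
  by apply/matrixP => i j; rewrite /seg !mxE; ring.
exact: seg_ball.
Qed.

Lemma tube_base x e : 0 < e -> tube x e x0.
Proof.
move=> e0; split=> //; exists 0; first by rewrite lexx ler01.
by rewrite seg0; apply: ballxx.
Qed.

Lemma tube_near x e z : C z -> ball x e z -> tube x e z.
Proof.
by move=> Cz xz; split=> //; exists 1; rewrite ?seg1 // ler01 lexx.
Qed.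

Lemma tube_open x e z : tube x e z ->
  exists2 d : R, 0 < d & forall w, C w -> ball z d w -> tube x e w.
Proof.
move=> [Cz [s s01 /colball_open[d d0 h]]]; exists d => // w Cw /h zw.
by split=> //; exists s.
Qed.

Definition liftable_along x :=
  exists2 e : R, 0 < e & exists2 phi, is_lift (tube x e) phi & phi x0 = y0.

(** A thin tube around [x0, x2] is covered by the tube around [x0, x1] and the
    ball around c. A deck transformation makes the local lift over the ball agree
    with the given one at x1, hence on the overlap, which is convex. *)
Lemma liftable_extend x c d psi s1 s2 : C x ->
  0 <= s1 <= 1 -> 0 <= s2 <= 1 -> 0 < d -> is_lift (C `&` ball c d) psi ->
  (forall s, s1 <= s <= s2 -> ball c (d / 2) (seg x0 x s)) ->
  ball c d (seg x0 x s1) ->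
  liftable_along (seg x0 x s1) -> liftable_along (seg x0 x s2).
Proof.
move=> Cx s101 s201 d0 psiL hball hb1 [e e0 [phi phiL phi0]].
pose x1 := seg x0 x s1; have Cx1 : C x1 by apply: Cconv.
have tx1 : tube x1 e x1 by apply: tube_near => //; apply: ballxx.
have [Yx1 px1] := proj2 phiL _ tx1.
have bx1 : (C `&` ball c d) x1 by [].
have [psi' psi'L psi'1] := lift_through psiL bx1 Yx1 px1.
have bconv : convex_set (C `&` ball c d) by apply: convex_setI => //; apply: convex_ball.
have agree z : tube x1 e z -> ball c d z -> psi' z = phi z.
  move=> tz bz; apply: (lifts_agree bconv (@convex_tube x1 e) psi'L phiL bx1 tx1) => //.
  by split=> //; case: tz.
pose chi z := if pselect (ball c d z) then psi' z else phi z.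
have chi_psi z : ball c d z -> chi z = psi' z by rewrite /chi; case: pselect.
have chi_phi z : tube x1 e z -> chi z = phi z.
  by rewrite /chi; case: pselect => // ? ?; apply: agree.
have m0 : 0 < Num.min e (d / 2) by rewrite lt_min e0 divr_gt0.
have cover z : tube (seg x0 x s2) (Num.min e (d / 2)) z -> ball c d z \/ tube x1 e z.
  move=> [Cz [t /andP[t0 t1]]]; rewrite seg_seg => bz.
  have /andP[s20 s21] := s201; have /andP[s10 s11] := s101.
  have [h|h] := leP (t * s2) s1.
    right; split=> //; exists (t * s2 / s1).
      have [->|s1n] := eqVneq s1 0; first by rewrite invr0 mulr0 lexx ler01.
      have s1p : 0 < s1 by rewrite lt0r s1n.
      by rewrite divr_ge0 ?mulr_ge0 //= ler_pdivrMr // mul1r.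
    have -> : seg x0 x1 (t * s2 / s1) = seg x0 x (t * s2).
      rewrite /x1 seg_seg; have [s1z|s1n] := eqVneq s1 0; last by rewrite divfK.
      have -> : t * s2 = 0 by apply/eqP; rewrite eq_le mulr_ge0 // andbT -s1z.
      by rewrite !mul0r.
    by apply: colball_le bz; rewrite ge_min lexx.
  left; have hc : ball c (d / 2) (seg x0 x (t * s2)).
    by apply: hball; rewrite ltW //= ler_piMl.
  rewrite (splitr d); apply: (ball_triangle hc).
  by apply: colball_le bz; rewrite ge_min lexx orbT.
exists (Num.min e (d / 2)) => //; exists chi; last first.
  by rewrite chi_phi //; apply: tube_base.
split=> z tz; last first.
  have Cz := proj1 tz; case: (cover z tz) => [bz|tz'].
    by rewrite chi_psi //; apply: (proj2 psi'L).
  by rewrite chi_phi //; apply: (proj2 phiL).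
move=> r r0; have Cz := proj1 tz; case: (cover z tz) => [bz|tz'].
  have [d1 d10 h1] := colball_open bz.
  have [d2 d20 h2] := proj1 psi'L z (conj Cz bz) r r0.
  exists (Num.min d1 d2) => [|w [Cw _] zw]; first by rewrite lt_min d10.
  have bw : ball c d w by apply: h1; apply: colball_le zw; rewrite ge_min lexx.
  rewrite !chi_psi //; apply: h2 => //.
  by apply: colball_le zw; rewrite ge_min lexx orbT.
have [d1 d10 h1] := tube_open tz'.
have [d2 d20 h2] := proj1 phiL z tz' r r0.
exists (Num.min d1 d2) => [|w [Cw _] zw]; first by rewrite lt_min d10.
have tw : tube x1 e w by apply: h1 => //; apply: colball_le zw; rewrite ge_min lexx.
rewrite !chi_phi //; apply: h2 => //.
by apply: colball_le zw; rewrite ge_min lexx orbT.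
Qed.

Lemma liftable x : C x -> liftable_along x.
Proof.
move=> Cx; rewrite -[x](seg1 x0).
apply: (@unit_interval_constant _ (fun s => liftable_along (seg x0 x s))).
  move=> s s01; have Cs : C (seg x0 x s) by apply: Cconv.
  have [d d0 [psi psiL]] := Floc Cs.
  have d2 : 0 < d / 2 by rewrite divr_gt0.
  have [d' d'0 hd'] := seg_cont x0 x s d2; exists d' => // s1 s2 s101 s201 h1 h2.
  apply: (liftable_extend Cx s101 s201 d0 psiL).
    move=> t /andP[t1 t2]; apply: hd'; move: h1 h2; rewrite !ltr_norml.
    by move=> /andP[? ?] /andP[? ?]; apply/andP; split; lra.
  by apply: colball_le (hd' _ h1); lra.
rewrite seg0; have [d d0 [psi psiL]] := Floc Cx0.
have [|psi' psi'L e] := lift_through psiL _ Yy0 py0; first by split=> //; apply: ballxx.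
exists d => //; exists psi' => //; have tb z : tube x0 d z -> (C `&` ball x0 d) z.
  by move=> [Cz [t _]]; rewrite segxx.
by split=> [|z /tb]; [apply: cont_on_sub (proj1 psi'L)|apply: (proj2 psi'L)].
Qed.

(** The lifting criterion for a simply connected source. The global lift takes at
    x the value at x of a lift over a tube around [x0, x]; near x it coincides
    with that single lift. *)
Lemma exists_lift : exists2 Phi, is_lift C Phi & Phi x0 = y0.
Proof.
have /choice[ephi hphi] : forall x, exists ep : R * ('cV[R]_a -> 'cV[R]_b),
    C x -> [/\ 0 < ep.1, is_lift (tube x ep.1) ep.2 & ep.2 x0 = y0].
  move=> x; have [Cx|nCx] := pselect (C x); last by exists (0, fun=> 0).
  by have [e e0 [phi h1 h2]] := liftable Cx; exists (e, phi).
pose Phi x := (ephi x).2 x.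
have agree x z : C x -> tube x (ephi x).1 z -> Phi z = (ephi x).2 z.
  move=> Cx tz; have Cz := proj1 tz.
  have [ex0 Lx ix] := hphi x Cx; have [ez0 Lz iz] := hphi z Cz.
  rewrite /Phi; apply: (lifts_agree (@convex_tube z _) (@convex_tube x _) Lz Lx) => //.
  - exact: tube_base.
  - exact: tube_base.
  - by rewrite ix iz.
  - by apply: tube_near => //; apply: ballxx.
exists Phi; last by rewrite /Phi; have [] := hphi x0 Cx0.
split=> x Cx; have [ex0 Lx ix] := hphi x Cx.
  have tx : tube x (ephi x).1 x by apply: tube_near => //; apply: ballxx.
  move=> r r0; have [d1 d10 h1] := tube_open tx.
  have [d2 d20 h2] := proj1 Lx x tx r r0.
  exists (Num.min d1 d2) => [|w Cw xw]; first by rewrite lt_min d10.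
  have tw : tube x (ephi x).1 w.
    by apply: h1 => //; apply: colball_le xw; rewrite ge_min lexx.
  rewrite (agree x w) // {1}/Phi; apply: h2 => //.
  by apply: colball_le xw; rewrite ge_min lexx orbT.
by apply: (proj2 Lx); apply: tube_near => //; apply: ballxx.
Qed.

End Lifting.

(** * Properly discontinuous actions *)

Lemma pigeonhole (T : Type) (D : set T) (h : nat -> T) :
  finite_set D -> (forall i, D (h i)) -> exists i j, (i < j)%N /\ h i = h j.
Proof.
move=> Df hD; have [//|no] := pselect (exists i j, (i < j)%N /\ h i = h j).
case: infinite_nat; apply: (@finite_set_of_inj _ _ setT h D) => // i j _ _ e.
case: (ltngtP i j) => // ij; case: no.
- by exists i, j.
- by exists j, i.
Qed.

Section MatrixGroupTheory.
Variables (R : realType) (k : nat) (G : set 'M[R]_k).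
Hypothesis hG : matrix_group G.

Lemma matrix_group_unit g : G g -> g \in unitmx.
Proof. by case: hG => _ _ hV /hV[]. Qed.

Lemma matrix_groupV g : G g -> G (invmx g).
Proof. by case: hG => _ _ hV /hV[]. Qed.

Lemma matrix_groupM g h : G g -> G h -> G (g *m h).
Proof. by case: hG => _ hM _; apply: hM. Qed.

Lemma matrix_group1 : G 1%:M.
Proof. by case: hG. Qed.

Lemma matrix_groupX g i : G g -> G (g ^+ i).
Proof.
move=> Gg; elim: i => [|i IH]; first exact: matrix_group1.
by rewrite exprS; apply: matrix_groupM.
Qed.

Lemma discrete_isolated1 : discrete_group G -> isolated G 1%:M.
Proof. by move=> h; apply/h/matrix_group1. Qed.

End MatrixGroupTheory.

Section Actions.
Variables (R : realType) (k m : nat) (G : set 'M[R]_k).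
Variable act : 'M[R]_k -> 'cV[R]_m -> 'cV[R]_m.
Variable Y : set 'cV[R]_m.
Hypotheses (hG : matrix_group G) (Gd : discrete_group G) (Gt : torsion_free G).
Hypothesis act1 : forall y, act 1%:M y = y.
Hypothesis actM : forall g h y, G g -> G h -> act (g *m h) y = act g (act h y).
Hypothesis act_cont : forall g, G g -> cont_on setT (act g).
Hypothesis act_proper : forall y, Y y -> exists2 d : R, 0 < d & exists c : R,
  forall g z, G g -> Y z -> ball y d z -> Y (act g z) -> ball y d (act g z) ->
  forall i j, `|g i j| <= c.

Lemma actK g y : G g -> act (invmx g) (act g y) = y.
Proof.
by move=> Gg; rewrite -actM ?mulVmx ?act1 //; [exact: matrix_group_unit hG _ _
  | exact: matrix_groupV].
Qed.

Lemma orbit_act g y : G g -> Defs.orbit act G (act g y) = Defs.orbit act G y.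
Proof.
move=> Gg; apply/seteqP; split=> w [h Gh <-].
  by exists (h *m g); [exact: matrix_groupM|exact: actM].
exists (h *m invmx g).
  by apply: matrix_groupM => //; apply: matrix_groupV.
by rewrite actM ?actK //; apply: matrix_groupV.
Qed.

(** Stabilizers are bounded, hence finite, hence trivial by torsion-freeness. *)
Lemma action_free g y : Y y -> G g -> act g y = y -> g = 1%:M.
Proof.
move=> Yy Gg gy; have [d d0 [c hc]] := act_proper Yy.
have fin : finite_set [set h | G h /\ act h y = y].
  apply: (discrete_bounded_finite hG (discrete_isolated1 hG Gd) (k := c)).
  - by move=> h [].
  - move=> h [Gh hy]; split; first exact: matrix_groupV.
    by rewrite -{1}hy actK.
  - move=> h [Gh hy]; have yy : ball y d y by apply: ballxx.
    by apply: (hc h y) => //; rewrite hy.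
have [|i [j [ij e]]] := pigeonhole (h := fun i => g ^+ i) fin.
  elim=> [|i [Gi iy]]; first by split; [exact: matrix_group1|exact: act1].
  rewrite exprS; split; first exact: matrix_groupM.
  by rewrite actM // iy.
apply: (Gt (k := (j - i)%N)) => //; first by rewrite subn_gt0.
have := matrix_group_unit hG (matrix_groupX hG i Gg).
move: e; rewrite -{1}(subnKC (ltnW ij)) exprD => /esym e u.
by rewrite -[LHS](mulKmx u) -[X in _ *m X]/(_ * _) e mulVmx.
Qed.

(** Near y only finitely many elements of G matter, and each of them other than
    1 moves y away from itself. *)
Lemma action_separated : locally_separated Y (Defs.orbit act G).
Proof.
move=> y Yy; have [d d0 [c hc]] := act_proper Yy.
pose B := [set g | G g /\
  exists z, [/\ Y z, ball y d z, Y (act g z) & ball y d (act g z)]].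
have Bfin : finite_set B.
  apply: (discrete_bounded_finite hG (discrete_isolated1 hG Gd) (k := c)).
  - by move=> h [].
  - move=> h [Gh [z [Yz bz Yhz bhz]]]; split; first exact: matrix_groupV.
    by exists (act h z); rewrite actK.
  - by move=> h [Gh [z [Yz bz Yhz bhz]]]; apply: (hc h z).
have sep g : G g -> exists2 e : R, 0 < e &
    forall z, Y z -> ball y e z -> ball y e (act g z) -> act g z = z.
  move=> Gg; have [gy|gy] := eqVneq (act g y) y.
    by exists d => // z _ _ _; rewrite (action_free Yy Gg gy) act1.
  have [e e0 he] := colball_separated gy.
  have [d' d'0 hd'] := act_cont Gg (I : setT y) e0.
  exists (Num.min e d') => [|z _ b1 b2]; first by rewrite lt_min e0.
  case: (he (act g z)).
    by apply: hd' => //; apply: colball_le b1; rewrite ge_min lexx orbT.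
  by apply: colball_le b2; rewrite ge_min lexx.
have /choice[ep hep] : forall g, exists e : R, 0 < e /\ (G g ->
    forall z, Y z -> ball y e z -> ball y e (act g z) -> act g z = z).
  move=> g; have [/sep[e e0 he]|nG] := pselect (G g); first by exists e.
  by exists 1.
have /finite_seqP[s sB] := Bfin.
have [e e0 he] := @fin_lower_bound R 'I_(size s) (fun i => ep (nth 0 s i))
  (fun i => proj1 (hep _)).
exists (Num.min d e) => [|z z' Yz Yz' bz bz' zz']; first by rewrite lt_min d0.
have [g Gg gz] : Defs.orbit act G z z'.
  by rewrite zz'; exists 1%:M; [exact: matrix_group1|exact: act1].
have Bg : B g.
  split=> //; exists z; rewrite gz; split=> //.
  - by apply: colball_le bz; rewrite ge_min lexx.
  - by apply: colball_le bz'; rewrite ge_min lexx.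
have gs : g \in s by move: Bg; rewrite sB.
have gi : (index g s < size s)%N by rewrite index_mem.
have := he (Ordinal gi); rewrite /= nth_index // => eg.
rewrite -gz; apply/esym; apply: (proj2 (hep g) Gg) => //.
  by apply: colball_le bz; rewrite ge_min eg orbT.
by rewrite gz; apply: colball_le bz'; rewrite ge_min eg orbT.
Qed.

End Actions.

Lemma cont_on_affine (R : realType) a b (M : 'M[R]_(b, a)) (u : 'cV[R]_b) :
  cont_on setT (fun v => M *m v + u).
Proof.
move=> x _ e e0; pose s := 1 + \sum_i \sum_j `|M i j|.
have s0 : 0 < s.
  by rewrite ltr_pwDl // sumr_ge0 // => i _; rewrite sumr_ge0.
exists (e / s); first by rewrite divr_gt0.
move=> y _ /colballP[_ xy]; apply/colballP; split=> // i.
have -> : (M *m x + u) i 0 - (M *m y + u) i 0 = \sum_j M i j * (x j 0 - y j 0).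
  rewrite !mxE opprD addrACA subrr addr0 -sumrB.
  by apply: eq_bigr => j _; rewrite mulrBr.
apply: (le_lt_trans (ler_norm_sum _ _ _)).
apply: (@le_lt_trans _ _ ((\sum_j `|M i j|) * (e / s))).
  rewrite mulr_suml; apply: ler_sum => j _; rewrite normrM.
  by apply: ler_wpM2l => //; apply/ltW.
rewrite mulrA ltr_pdivrMr // mulrC ltr_pM2l // /s (bigD1 i) //=.
rewrite addrCA ltrDl ltr_pwDl // sumr_ge0 // => j _.
by rewrite sumr_ge0.
Qed.

Lemma cont_on_mulmx (R : realType) a b (C : set 'cV[R]_a) (M : 'M[R]_(b, a)) :
  cont_on C (fun v => M *m v).
Proof.
have -> : (fun v : 'cV[R]_a => M *m v) = fun v => M *m v + 0.
  by apply/funext => v; rewrite addr0.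
by apply: cont_on_sub (@cont_on_affine _ _ _ _ _).
Qed.

(** ** The action of a crystallographic group on the half space *)

Section EuclideanAction.
Variables (R : realType) (n : nat) (GB : set 'M[R]_(n + 1)).
Hypotheses (GBe : GB `<=` @euclidean_isometries R n) (GBg : matrix_group GB).
Hypotheses (GBd : discrete_group GB) (GBt : torsion_free GB).

Lemma half_space_act1 (x : 'cV[R]_(n + 1)) : half_space_act 1%:M x = x.
Proof.
rewrite /half_space_act /affine_act scalar_mx_block block_mxKul block_mxKur.
by rewrite mul1mx addr0 vsubmxK.
Qed.

Lemma euclidean_ulsubM (g h : 'M[R]_(n + 1)) :
  euclidean_isometries g -> euclidean_isometries h ->
  ulsubmx (g *m h) = ulsubmx g *m ulsubmx h.
Proof.
move=> [A [b [_ ->]]] [A' [b' [_ ->]]].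
by rewrite mulmx_block !block_mxKul mulmx0 addr0.
Qed.

Lemma euclidean_ursubM (g h : 'M[R]_(n + 1)) :
  euclidean_isometries g -> euclidean_isometries h ->
  ursubmx (g *m h) = ulsubmx g *m ursubmx h + ursubmx g.
Proof.
move=> [A [b [_ ->]]] [A' [b' [_ ->]]].
by rewrite mulmx_block !block_mxKul !block_mxKur mulmx1.
Qed.

Lemma euclidean_eq (g h : 'M[R]_(n + 1)) :
  euclidean_isometries g -> euclidean_isometries h ->
  ulsubmx g = ulsubmx h -> ursubmx g = ursubmx h -> g = h.
Proof.
move=> [A [b [_ ->]]] [A' [b' [_ ->]]].
by rewrite !block_mxKul !block_mxKur => -> ->.
Qed.

Lemma half_space_actM (g h : 'M[R]_(n + 1)) x : GB g -> GB h ->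
  half_space_act (g *m h) x = half_space_act g (half_space_act h x).
Proof.
move=> /GBe ge /GBe he; rewrite /half_space_act /affine_act.
rewrite euclidean_ulsubM // euclidean_ursubM // !col_mxKu !col_mxKd.
by rewrite mulmxDr !mulmxA addrA.
Qed.

Lemma half_space_act_cont (g : 'M[R]_(n + 1)) : cont_on setT (half_space_act g).
Proof.
have -> : half_space_act g = fun x => block_mx (ulsubmx g) 0 0 1%:M *m x
    + col_mx (ursubmx g) 0.
  apply/funext => x; rewrite -{2}(vsubmxK x) mul_block_col add_col_mx.
  by rewrite !mul0mx mul1mx !addr0 add0r.
exact: cont_on_affine.
Qed.

Lemma orthogonal_entry (A : 'M[R]_n) i j : A^T *m A = 1%:M -> `|A i j| <= 1.
Proof.
move=> /matrixP /(_ j j); rewrite !mxE eqxx (bigD1 i) //= mxE => h.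
have s0 : 0 <= \sum_(k | k != i) A^T j k * A k j.
  by apply: sumr_ge0 => k _; rewrite mxE -expr2 sqr_ge0.
have : `|A i j| ^+ 2 <= 1 by rewrite real_normK ?num_real // expr2; lra.
by rewrite expr_le1.
Qed.

Lemma half_space_act_proper (y : 'cV[R]_(n + 1)) : exists2 d : R, 0 < d &
  exists c : R, forall g z, GB g -> ball y d z -> ball y d (half_space_act g z) ->
  forall i j, `|g i j| <= c.
Proof.
exists 1 => //; pose s := \sum_i (`|y i 0| + 1).
have s0 : 0 <= s by apply: sumr_ge0 => i _; rewrite addr_ge0.
exists (1 + s + s) => g z /GBe[A [b [AO ->]]] /colballP[_ yz] /colballP[_ ygz].
have bd (w : 'cV[R]_(n + 1)) i : `|y i 0 - w i 0| < 1 -> `|w i 0| <= `|y i 0| + 1.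
  move=> h; have := ler_distD 0 (w i 0) (y i 0); rewrite !subr0 => _.
  have := ler_normB (y i 0) (y i 0 - w i 0); rewrite opprB addrC subrK; lra.
have bs i : `|y i 0| + 1 <= s.
  rewrite /s (bigD1 i) //= lerDl sumr_ge0 // => j _; exact: addr_ge0.
have hb i : `|b i 0| <= s + s.
  have := bd _ _ (ygz (lshift 1 i)).
  rewrite /half_space_act /affine_act col_mxEu block_mxKul block_mxKur => h.
  have -> : b i 0 = (A *m usubmx z + b) i 0 - (A *m usubmx z) i 0.
    by rewrite !mxE addrC addKr.
  apply: (le_trans (ler_normB _ _)); apply: lerD; first exact: le_trans h (bs _).
  rewrite mxE; apply: (le_trans (ler_norm_sum _ _ _)).
  rewrite /s big_split_ord /= -[leLHS]addr0; apply: lerD; last first.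
    by apply: sumr_ge0 => j _; rewrite addr_ge0.
  apply: ler_sum => j _; rewrite normrM -[leRHS]mul1r mxE.
  by apply: ler_pM => //; [exact: orthogonal_entry|exact: bd].
move=> i j; case: (split_ordP i) => i' ->; case: (split_ordP j) => j' ->.
- rewrite block_mxEul; have := orthogonal_entry i' j' AO; lra.
- rewrite block_mxEur ord1; have := hb i'; lra.
- by rewrite block_mxEdl mxE normr0; lra.
- by rewrite block_mxEdr !ord1 mxE eqxx normr1; lra.
Qed.

Lemma half_space_separated :
  locally_separated (@half_space R n) (half_space_orbit GB).
Proof.
apply: action_separated => //.
- exact: half_space_act1.
- by move=> *; apply: half_space_actM.
- by move=> g _; apply: half_space_act_cont.
- move=> y _; have [d d0 [c hc]] := half_space_act_proper y.
  by exists d => //; exists c => g z Gg _ bz _ bgz; apply: (hc g z).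
Qed.

End EuclideanAction.

(** * Horoballs *)

Lemma posdef_unit (R : realFieldType) n (Q : 'M[R]_n) : posdef Q -> Q \in unitmx.
Proof.
move=> Qp; rewrite -row_free_unit -kermx_eq0; apply: contraT => k0.
have [i ri] : exists i, row i (kermx Q) != 0.
  apply/existsP; rewrite -negb_forall; apply: contra k0 => /forallP h.
  by apply/eqP/row_matrixP => i; rewrite row0; apply/eqP.
have := Qp (row i (kermx Q))^T; rewrite /bil trmxK -row_mul mulmx_ker row0 mul0mx mxE.
rewrite ltxx => h; suff : false by []; apply: h.
by apply: contra ri => /eqP e; rewrite -(trmxK (row i _)) e trmx0.
Qed.

Lemma posdef_osum (R : realFieldType) m n (A : 'M[R]_m) (B : 'M[R]_n) :
  posdef A -> posdef B -> posdef (osum A B).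
Proof.
move=> Ap Bp v; rewrite -(vsubmxK v) bil_osum.
have [->|/Ap a0] := eqVneq (usubmx v) 0; have [->|/Bp b0] := eqVneq (dsubmx v) 0.
- by rewrite col_mx0 eqxx.
- by rewrite bil0l add0r.
- by rewrite bil0l addr0.
- by move=> _; apply: addr_gt0.
Qed.

Lemma posdef_form1 (R : realFieldType) (a : R) : 0 < a -> posdef (form1 a).
Proof.
move=> a0 v v0; rewrite bil_form1 mulr_gt0 // -expr2 exprn_even_gt0 //=.
by apply: contra_neq v0 => h; rewrite [v]mx11_scalar h -scalemx1 scale0r.
Qed.

Lemma osum_sym (K : comUnitRingType) m n (A : 'M[K]_m) (B : 'M[K]_n) :
  A^T = A -> B^T = B -> (osum A B)^T = osum A B.
Proof. by move=> As Bs; rewrite /osum tr_block_mx As Bs !trmx0. Qed.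

Lemma form1_sym (K : comUnitRingType) (a : K) : (form1 a)^T = form1 a.
Proof. exact: tr_scalar_mx. Qed.

Lemma to_real_lorentz (R : realType) n (f : 'M[rat]_n) :
  to_real R (lorentz (osum f (form1 1))) = qform (to_real R f).
Proof.
rewrite /to_real /lorentz /qform /osum /form1 !map_block_mx !map_scalar_mx.
by rewrite !map_mx0 /= rmorphN1 rmorph1.
Qed.

Lemma bil_sum (K : comUnitRingType) n (Q : 'M[K]_n) x y :
  bil Q x y = \sum_j (\sum_i x i 0 * Q i j) * y j 0.
Proof.
rewrite /bil mxE; apply: eq_bigr => j _; rewrite mxE; congr (_ * _).
by apply: eq_bigr => i _; rewrite mxE.
Qed.

Definition cont_at (R : realType) (T : topologicalType) (w : T) (g : T -> R) :=
  g @ w --> g w.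

Section ContAt.
Variables (R : realType) (T : topologicalType) (w : T).
Implicit Types g h : T -> R.

Lemma cont_at_cst (c : R) : cont_at w (fun=> c).
Proof. exact: cvg_cst. Qed.

Lemma cont_atD g h : cont_at w g -> cont_at w h -> cont_at w (fun x => g x + h x).
Proof. exact: cvgD. Qed.

Lemma cont_atM g h : cont_at w g -> cont_at w h -> cont_at w (fun x => g x * h x).
Proof. exact: cvgM. Qed.

Lemma cont_atV g : g w != 0 -> cont_at w g -> cont_at w (fun x => (g x)^-1).
Proof. exact: cvgV. Qed.

Lemma cont_at_sum (I : finType) (g : I -> T -> R) :
  (forall i, cont_at w (g i)) -> cont_at w (fun x => \sum_i g i x).
Proof.
move=> h; have -> : (fun x => \sum_i g i x) = \sum_i g i.
  by apply/funext => x; rewrite fct_sumE.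
elim/big_ind: _ => //; first exact: cont_at_cst.
by move=> u v; apply: cont_atD.
Qed.

End ContAt.

Lemma cont_at_bil (R : realType) n (Q : 'M[R]_n) a (w : 'cV[R]_a)
    (g h : 'cV[R]_a -> 'cV[R]_n) :
  (forall i, cont_at w (fun x => g x i 0)) ->
  (forall i, cont_at w (fun x => h x i 0)) ->
  cont_at w (fun x => bil Q (g x) (h x)).
Proof.
move=> hg hh; have -> : (fun x => bil Q (g x) (h x)) =
    fun x => \sum_j (\sum_i g x i 0 * Q i j) * h x j 0.
  by apply/funext => x; rewrite bil_sum.
apply: cont_at_sum => j; apply: cont_atM => //; apply: cont_at_sum => i.
by apply: cont_atM => //; apply: cont_at_cst.
Qed.

Lemma cont_at_coord (R : realType) a (w : 'cV[R]_a) i :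
  cont_at w (fun x : 'cV[R]_a => x i 0).
Proof. exact: coord_continuous. Qed.

Lemma cont_at_ball (R : realType) a b (phi : 'cV[R]_a -> 'cV[R]_b) x :
  (forall i, cont_at x (fun y => phi y i 0)) ->
  forall e : R, 0 < e ->
    exists2 d : R, 0 < d & forall y, ball x d y -> ball (phi x) e (phi y).
Proof.
move=> h e e0; have /choice[d hd] : forall i, exists d : R, 0 < d /\
    forall y, ball x d y -> `|phi x i 0 - phi y i 0| < e.
  move=> i; have /cvgrPdist_lt /(_ _ e0) /nbhs_ballP[d /= d0 hd] := h i.
  by exists d.
have [d1 d10 hd1] := @fin_lower_bound _ _ d (fun i => proj1 (hd i)).
exists d1 => // y xy; apply/colballP; split=> // i.
by apply: (proj2 (hd i)); apply: colball_le xy.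
Qed.

Section Cone.
Variables (R : realFieldType) (n : nat) (f : 'M[R]_n).
Hypotheses (fs : f^T = f) (fp : posdef f).

Let p := osum f (form1 1).

Lemma cone_sym : p^T = p.
Proof. by apply: osum_sym => //; apply: form1_sym. Qed.

Lemma cone_posdef : posdef p.
Proof. by apply: posdef_osum => //; apply: posdef_form1. Qed.

Lemma cone_unit : p \in unitmx.
Proof. exact/posdef_unit/cone_posdef. Qed.

Lemma qform_unit : qform f \in unitmx.
Proof.
rewrite unitmxE /qform /osum det_ublock unitrM -!unitmxE cone_unit.
by rewrite unitmxE det_scalar expr1 unitrN1.
Qed.

End Cone.

Section Horoball.
Variables (R : realType) (n : nat) (f : 'M[R]_n).
Hypotheses (fs : f^T = f) (fp : posdef f).

Let Q := qform f.

(** Reversed Cauchy-Schwarz: the sign of the pairing with a future isotropic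
    vector tells the two sheets apart. *)
Lemma future_pairing x xi :
  bil Q x x = -1 -> bil Q xi xi = 0 -> 0 < height xi ->
  (bil Q x xi < 0) = (0 < height x).
Proof.
move=> qx qxi hxi.
have := lorentz_cauchy_schwarz (cone_sym fs) (cone_posdef fp) x xi.
rewrite -/(qform f) -/Q qx qxi -/(height x) -/(height xi).
move: (bil Q x xi) (height x) (height xi) hxi => s a b b0 h.
have h1 : s ^+ 2 + 2 * (s * (a * b)) + b ^+ 2 <= 0 by move: h; nra.
have s2 := sqr_ge0 s; have b2 : 0 < b ^+ 2 by rewrite exprn_gt0.
apply/idP/idP => [sn|ap]; rewrite ltNge; apply/negP => hn.
  have ab : a * b <= 0 by rewrite pmulr_lle0.
  have := mulr_le0 (ltW sn) ab.
  lra.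
have := mulr_ge0 hn (mulr_ge0 (ltW ap) (ltW b0)).
lra.
Qed.

Lemma dual_isotropic xi : bil Q xi xi = 0 -> xi != 0 ->
  exists eta, bil Q eta eta = 0 /\ bil Q xi eta = -1.
Proof.
move=> qx x0; have [S [c [SQ c0 Sx]]] := isotropic_transitive fs fp x0 qx.
exists (c *: (S *m eta0 R n)); rewrite !bilE !bil_orthogonal // bil_eta0_eta0.
split; first by rewrite !mulr0.
have -> : xi = c^-1 *: (S *m xi0 R n) by rewrite Sx scalerA mulVf // scale1r.
by rewrite bilE bil_orthogonal // bil_xi0_eta0 mulrA divff // mul1r.
Qed.

Section Coordinates.
Variables xi eta : 'cV[R]_(n + 1 + 1).
Hypotheses (qxi : bil Q xi xi = 0) (hxi : 0 < height xi).
Hypotheses (qeta : bil Q eta eta = 0) (xieta : bil Q xi eta = -1).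

Let Qs : Q^T = Q := qform_sym fs.

(** The horoball of level 1, with the form and the sheet written out. *)
Definition horo := [set x | [/\ bil Q x x = -1, 0 < height x & -1 <= bil Q x xi]].

(** Horospherical coordinates: along the direction xi the horoball is a graph
    over the convex set [horo_base]. *)
Definition horo_base : set 'cV[R]_(n + 1 + 1) :=
  [set w | bil Q w eta = 0 /\ -1 <= bil Q w xi < 0].

Definition horo_param (w : 'cV[R]_(n + 1 + 1)) :=
  w + ((1 + bil Q w w) * (- 2 * bil Q w xi)^-1) *: xi.

Definition horo_coord (x : 'cV[R]_(n + 1 + 1)) := x + bil Q x eta *: xi.

Lemma horo_base_convex : convex_set horo_base.
Proof.
move=> x y s [x1 /andP[x2 x3]] [y1 /andP[y2 y3]] /andP[s0 s1].
rewrite /horo_base /seg /= !bilE x1 y1; split; first by ring.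
move: (bil Q x xi) (bil Q y xi) x2 x3 y2 y3 => a b *; apply/andP; split; first by nra.
by have [ab|ab] := leP a b; nra.
Qed.

Lemma horo_param_in w : horo_base w -> horo (horo_param w).
Proof.
move=> [w1 /andP[w2 w3]]; have bn : bil Q w xi != 0 by rewrite lt_eqF.
have e1 : bil Q (horo_param w) xi = bil Q w xi.
  by rewrite /horo_param !bilE qxi mulr0 addr0.
have e2 : bil Q (horo_param w) (horo_param w) = -1.
  rewrite /horo_param !bilE qxi (bilC xi w Qs); field; exact: bn.
by split=> //; [rewrite -(future_pairing e2 qxi hxi) e1|rewrite e1].
Qed.

Lemma horo_coord_in x : horo x -> horo_base (horo_coord x).
Proof.
move=> [x1 x2 x3]; rewrite /horo_base /horo_coord /= !bilE qxi xieta mulrN1 subrr.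
by rewrite mulr0 addr0 x3 future_pairing.
Qed.

Lemma horo_coordK x : horo x -> horo_param (horo_coord x) = x.
Proof.
move=> [x1 x2 x3]; have b0 : bil Q x xi < 0 by rewrite future_pairing.
rewrite /horo_param /horo_coord !bilE qxi x1 (bilC xi x Qs).
rewrite -[RHS]addr0 -addrA -scalerDl; congr (_ + _).
rewrite [X in X *: _](_ : _ = 0) ?scale0r //.
by field; rewrite lt_eqF.
Qed.

Lemma horo_coord_cont : cont_on setT horo_coord.
Proof.
have -> : horo_coord = fun x => (1%:M + xi *m (Q *m eta)^T) *m x + 0.
  apply/funext => x; rewrite /horo_coord addr0 mulmxDl mul1mx; congr (_ + _).
  rewrite trmx_mul -mulmxA [X in _ *m X]mx11_scalar mul_mx_scalar.
  by rewrite (bilC _ _ Qs) /bil Qs.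
exact: cont_on_affine.
Qed.

Lemma horo_param_cont w : bil Q w xi != 0 -> forall e : R, 0 < e ->
  exists2 d : R, 0 < d &
    forall y, ball w d y -> ball (horo_param w) e (horo_param y).
Proof.
move=> w0; apply: cont_at_ball => i.
have -> : (fun y => horo_param y i 0) = fun y =>
    y i 0 + ((1 + bil Q y y) * (- 2 * bil Q y xi)^-1) * xi i 0.
  by apply/funext => y; rewrite 2!mxE.
have coord := @cont_at_coord R _ w; have cst := @cont_at_cst R _ w.
apply: cont_atD => //; apply: cont_atM => //; apply: cont_atM.
  by apply: cont_atD => //; apply: cont_at_bil.
apply: cont_atV; first by rewrite mulf_neq0 // oppr_eq0.
by apply: cont_atM => //; apply: cont_at_bil.
Qed.

(** For the points b eta + xi / 2b of the horoball, with 0 < b <= 1, the pairing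
    with g xi stays in [-1, 0). As b tends to 0 this forces g xi to be orthogonal
    to xi, hence equal to a xi for some a > 0; b = 1 gives a <= 1, and the image
    under g of the point b = 1 gives a >= 1. *)
Lemma horo_stabilizer g : g^T *m Q *m g = Q ->
  [set g *m x | x in horo] = horo -> g *m xi = xi.
Proof.
move=> gQ gH; have gb := fun x y => @bil_orthogonal _ _ Q g x y gQ.
pose x b := b *: eta + (2 * b)^-1 *: xi.
have xQ b : 0 < b -> bil Q (x b) xi = - b.
  by move=> b0; rewrite /x !bilE qxi (bilC eta xi Qs) xieta; ring.
have xH b : 0 < b <= 1 -> horo (x b).
  move=> /andP[b0 b1]; have qx : bil Q (x b) (x b) = -1.
    by rewrite /x !bilE qxi qeta (bilC eta xi Qs) xieta; field; rewrite gt_eqF.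
  split=> //; last by rewrite xQ // lerN2.
  by rewrite -(future_pairing qx qxi hxi) xQ // oppr_lt0.
set xi' := g *m xi; pose be := bil Q xi xi'; pose al := bil Q eta xi'.
have key b : 0 < b <= 1 -> -1 <= b * al + (2 * b)^-1 * be < 0.
  move=> b01; have : horo (x b) by apply: xH.
  rewrite -{1}gH => -[y [y1 y2 y3] yx].
  have -> : b * al + (2 * b)^-1 * be = bil Q (x b) xi' by rewrite /x !bilE.
  by rewrite -yx gb y3 future_pairing.
have be0 : be = 0.
  apply/eqP; rewrite eq_le; apply/andP; split.
    rewrite leNgt; apply/negP => bp.
    pose b := be / (1 + be + 2 * `|al|).
    have d0 : 0 < 1 + be + 2 * `|al| by have := normr_ge0 al; lra.
    have b0 : 0 < b by rewrite divr_gt0.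
    have b1 : b <= 1 by rewrite ler_pdivrMr // mul1r; have := normr_ge0 al; lra.
    have /key/andP[_] : 0 < b <= 1 by rewrite b0.
    have -> : (2 * b)^-1 * be = (1 + be + 2 * `|al|) / 2.
      by rewrite /b; field; rewrite !gt_eqF.
    have : `|b * al| <= `|al| by rewrite normrM gtr0_norm // ler_piMl.
    by rewrite ler_norml => /andP[h _]; lra.
  rewrite leNgt; apply/negP => bn.
  pose b := - be / (3 - be + 2 * `|al|).
  have d0 : 0 < 3 - be + 2 * `|al| by have := normr_ge0 al; lra.
  have b0 : 0 < b by rewrite divr_gt0 // oppr_gt0.
  have b1 : b <= 1 by rewrite ler_pdivrMr // mul1r; have := normr_ge0 al; lra.
  have /key/andP[+ _] : 0 < b <= 1 by rewrite b0.
  have -> : (2 * b)^-1 * be = - ((3 - be + 2 * `|al|) / 2).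
    by rewrite /b; field; rewrite gt_eqF // lt_eqF.
  have : `|b * al| <= `|al| by rewrite normrM gtr0_norm // ler_piMl.
  by rewrite ler_norml => /andP[_ h]; lra.
have xi_n0 : xi != 0 by apply: contraTneq hxi => ->; rewrite /height linear0 mxE ltxx.
(* xi' is isotropic and orthogonal to xi, hence a multiple of xi *)
have [a xi'E] : exists a, xi' = a *: xi.
  have [S [c [SQ c0 Sx]]] := isotropic_transitive fs fp xi_n0 qxi.
  have Su : S \in unitmx.
    exact: orthogonal_unit (qform_unit fp) SQ.
  have ViQ : (invmx S)^T *m Q *m invmx S = Q.
    by apply: orthogonal_bil => u v; rewrite -(bil_orthogonal _ _ SQ) !mulKVmx.
  have := @isotropic_collinear _ _ f fs (invmx S *m xi') fp.
  have -> : xi0 R n = invmx S *m (c *: xi) by rewrite -Sx mulKmx.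
  have qxi' : bil Q xi' xi' = 0 by rewrite gb.
  rewrite -/Q !(bil_orthogonal _ _ ViQ) qxi' bilE (bilC _ _ Qs) -/be be0 mulr0.
  move=> /(_ erefl erefl) e; exists (- bil Q (invmx S *m xi') (eta0 R n) * c).
  by rewrite -[LHS](mulKVmx Su) [X in S *m X = _]e -scalemxAr mulKVmx // scalerA.
have alE : al = - a by rewrite /al xi'E bilE (bilC eta xi Qs) xieta mulrN1.
have a1 : a <= 1.
  have /key/andP[+ _] : 0 < (1 : R) <= 1 by rewrite ltr01 lexx.
  by rewrite be0 alE mulr0 addr0 mul1r lerN2.
have a0 : 0 < a.
  have /key/andP[_] : 0 < (1 : R) <= 1 by rewrite ltr01 lexx.
  by rewrite be0 alE mulr0 addr0 mul1r oppr_lt0.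
have a2 : 1 <= a.
  have : horo (g *m x 1).
    by rewrite -gH; exists (x 1) => //; apply: xH; rewrite ltr01 lexx.
  move=> [_ _]; have -> : xi = a^-1 *: xi' by rewrite xi'E scalerA mulVf ?gt_eqF // scale1r.
  rewrite bilE gb xQ // mulrN1 lerN2 => h.
  by rewrite -(@ler_pM2l _ a^-1) ?invr_gt0 // mulVf ?gt_eqF // mulr1.
by rewrite -/xi' xi'E (_ : a = 1) ?scale1r //; apply/eqP; rewrite eq_le a1.
Qed.

End Coordinates.
End Horoball.

(** * The cusp group *)

Lemma smooth_local_lift (R : realType) a b (X : set 'cV[R]_a)
    (pX : 'cV[R]_a -> set 'cV[R]_a) (Y : set 'cV[R]_b)
    (pY : 'cV[R]_b -> set 'cV[R]_b) F :
  smooth_quotient_map X pX Y pY F ->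
  forall x, X x -> exists2 d : R, 0 < d &
    exists phi, is_lift Y pY (F \o pX) (X `&` ball x d) phi.
Proof.
move=> hF x Xx; have [V [phi [Vo Vx sm hV]]] := hF x Xx.
have /nbhs_ballP[d /= d0 dV] : nbhs x V by apply: open_nbhs_nbhs.
exists d => //; exists phi; split=> [y [Xy xy] e e0|y [Xy xy]]; last first.
  by have [? /= <-] := hV y (dV _ xy) Xy.
have [c _] := sm [::] y (dV _ xy).
have /cvg_ballP /(_ _ e0) /nbhs_ballP[d' /= d'0 hd'] := c.
by exists d' => // z _ /hd'.
Qed.

Section CuspGroup.
Variables (R : realType) (n : nat) (GB : set 'M[R]_(n + 1)).
Hypotheses (GBe : GB `<=` @euclidean_isometries R n) (GBg : matrix_group GB).
Hypotheses (GBd : discrete_group GB) (GBt : torsion_free GB).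
Variable f : 'M[rat]_n.
Hypotheses (fs : f^T = f) (fpos : positive_definite f).
Variable G : set 'M[R]_(n + 1 + 1).

Let p := osum f (form1 1).
Let fR := to_real R f.
Let Q := qform fR.

Hypotheses (Gg : matrix_group G) (Gd : discrete_group G) (Gt : torsion_free G).
Hypothesis GO : G `<=` @Oplus R (n + 1) p.

Lemma to_real_sym : fR^T = fR.
Proof. by rewrite /fR /to_real matrix.map_trmx fs. Qed.

Lemma to_real_posdef : posdef fR.
Proof. exact: posdef_real. Qed.

Let fRs := to_real_sym.
Let fRp := to_real_posdef.

Lemma Oplus_orthogonal g : G g -> g^T *m Q *m g = Q.
Proof. by move=> /GO[[_]]; rewrite to_real_lorentz. Qed.

Lemma horoballE xi : horoball p xi = horo fR xi.
Proof.
apply/seteqP; split=> x; rewrite /horoball /hyperbolic_space /= to_real_lorentz.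
  by move=> [[? ?] ?]; split.
by move=> [? ? ?].
Qed.

Lemma lorentz_proper (y : 'cV[R]_(n + 1 + 1)) :
  exists2 d : R, 0 < d & exists c : R, forall g z, G g -> bil Q z z = -1 ->
    ball y d z -> ball y d (g *m z) -> forall i j, `|g i j| <= c.
Proof.
exists 1 => //.
have [c hc] := isometry_bound (cone_sym fRs) (cone_unit fRp) (cone_posdef fRp)
  (`|height y| + 1).
exists c => g z Gg' qz /colballP[_ yz] /colballP[_ ygz].
have bd (w : 'cV[R]_(n + 1 + 1)) : (forall i, `|y i 0 - w i 0| < 1) ->
    `|height w| <= `|height y| + 1.
  move=> h; have := h (rshift (n + 1) 0).
  have e (v : 'cV[R]_(n + 1 + 1)) : v (rshift (n + 1) 0) 0 = height v by rewrite /height mxE.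
  rewrite !e => h'; have := ler_normB (height y) (height y - height w).
  by rewrite opprB addrC subrK; lra.
by apply: (hc g z) => //; [exact: Oplus_orthogonal|exact: bd|exact: bd].
Qed.

Lemma lorentz_separated (Y : set 'cV[R]_(n + 1 + 1)) :
  (forall y, Y y -> bil Q y y = -1) -> locally_separated Y (hyperbolic_orbit G).
Proof.
move=> Yq; apply: action_separated => //.
- by move=> y; rewrite mul1mx.
- by move=> g h y _ _; rewrite mulmxA.
- by move=> g _; apply: cont_on_mulmx.
- move=> y _; have [d d0 [c hc]] := lorentz_proper y; exists d => //.
  by exists c => g z ? /Yq ? ? ? ?; apply: (hc g z).
Qed.

Lemma lorentz_free g y : G g -> bil Q y y = -1 -> g *m y = y -> g = 1%:M.
Proof.
move=> Gg' qy; apply: (@action_free _ _ _ G (fun g x => g *m x)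
  [set y | bil Q y y = -1]) => //.
- by move=> z; rewrite mul1mx.
- by move=> a b z _ _; rewrite mulmxA.
- move=> z _; have [d d0 [c hc]] := lorentz_proper z; exists d => //.
  by exists c => a w ? ? ? ? ?; apply: (hc a w).
Qed.

Lemma hyperbolic_orbit_act g x : G g ->
  hyperbolic_orbit G (g *m x) = hyperbolic_orbit G x.
Proof.
apply: (orbit_act (act := fun (g : 'M[R]_(n + 1 + 1)) (x : 'cV[R]_(n + 1 + 1)) =>
  g *m x)) => // [y|a b y _ _]; first exact: mul1mx.
by rewrite mulmxA.
Qed.

Variable xi : 'cV[R]_(n + 1 + 1).
Hypothesis hcusp : cusp_horoball p G xi.

Let Y := horo fR xi.
Let pY := @hyperbolic_orbit R (n + 1) G.
Let X := @half_space R n.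
Let pX := half_space_orbit GB.

Lemma cusp_isotropic : bil Q xi xi = 0 /\ 0 < height xi.
Proof. by have [[]] := hcusp; rewrite to_real_lorentz. Qed.

Lemma cusp_nonzero : xi != 0.
Proof.
apply: contraTneq (proj2 cusp_isotropic) => ->.
by rewrite /height linear0 mxE ltxx.
Qed.

Lemma horo_hyperbolic y : Y y -> bil Q y y = -1.
Proof. by case. Qed.

(** Precise invariance: an element of G carrying some point of the horoball
    into the horoball stabilizes it. *)
Lemma horo_orbit y y' : Y y -> Y y' -> pY y = pY y' ->
  exists g, [/\ G g, g *m y = y', g *m xi = xi & forall z, Y z -> Y (g *m z)].
Proof.
move=> Yy Yy' e; have [g Gg' gy] : pY y y'.
  by rewrite e; exists 1%:M; [exact: matrix_group1|rewrite mul1mx].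
exists g; have [qxi hxi] := cusp_isotropic.
have [eta [qeta xieta]] := dual_isotropic fRs fRp qxi cusp_nonzero.
have gY : [set g *m x | x in Y] = Y.
  have [_ _ /(_ g Gg')] := hcusp; rewrite horoballE => -[//|d].
  have : ([set g *m x | x in Y] `&` Y) y' by split=> //; exists y.
  by rewrite d.
split=> //.
  exact: (horo_stabilizer fRs fRp qxi hxi qeta xieta (Oplus_orthogonal Gg') gY).
by move=> z Yz; rewrite -gY; exists z.
Qed.

Lemma horo_deck y y' : Y y -> Y y' -> pY y = pY y' ->
  exists h : 'cV[R]_(n + 1 + 1) -> 'cV[R]_(n + 1 + 1),
    [/\ h y = y', cont_on Y h & forall z, Y z -> Y (h z) /\ pY (h z) = pY z].
Proof.
move=> Yy Yy' e; have [g [Gg' gy _ gY]] := horo_orbit Yy Yy' e.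
exists (fun z => g *m z); split=> //; first exact: cont_on_mulmx.
by move=> z /gY Yz; split=> //; apply: hyperbolic_orbit_act.
Qed.

Lemma half_space_actX g x : X x -> X (half_space_act g x).
Proof. by rewrite /X /half_space /= /half_space_act col_mxKd. Qed.

Lemma half_space_orbit_act g x : GB g -> pX (half_space_act g x) = pX x.
Proof.
apply: orbit_act => //; first exact: half_space_act1.
by move=> a b y ha hb; apply: (half_space_actM GBe).
Qed.

Lemma half_space_deck y y' : X y -> X y' -> pX y = pX y' ->
  exists h : 'cV[R]_(n + 1) -> 'cV[R]_(n + 1),
    [/\ h y = y', cont_on X h & forall z, X z -> X (h z) /\ pX (h z) = pX z].
Proof.
move=> Xy Xy' e; have [g Gg' gy] : pX y y'.
  by rewrite e; exists 1%:M; [exact: matrix_group1|exact: half_space_act1].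
exists (half_space_act g); split=> //.
  by apply: cont_on_sub (@half_space_act_cont _ _ _).
by move=> z Xz; split; [exact: half_space_actX|exact: half_space_orbit_act].
Qed.

Lemma half_space_convex : convex_set X.
Proof.
move=> x y s Xx Xy /andP[s0 s1]; rewrite /X /half_space /seg /=.
rewrite linearD linearZ /= linearB /= !mxE.
move: Xx Xy; rewrite /X /half_space /= !mxE => Xx Xy; nra.
Qed.

Lemma half_space0 : X 0.
Proof. by rewrite /X /half_space /= linear0 mxE. Qed.

(** The diffeomorphism and its inverse both lift to the universal covers. The
    composite of the lifts lifts the identity and fixes the origin, so it is the
    identity: this makes Phi injective. For g in GB, the maps Phi and Phi g lift
    the same map, so they differ by an element h of G, which preserves the
    horoball. *)
Lemma cusp_embedding : diffeomorphic_quotients X pX (horoball p xi) pY ->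
  exists Phi : 'cV[R]_(n + 1) -> 'cV[R]_(n + 1 + 1),
    [/\ forall x, X x -> Y (Phi x),
        forall x y, X x -> X y -> Phi x = Phi y -> x = y &
        forall g, GB g -> exists h, [/\ G h, h *m xi = xi &
          forall x, X x -> Phi (half_space_act g x) = h *m Phi x]].
Proof.
rewrite horoballE => -[F [F' [/smooth_local_lift hF /smooth_local_lift hF' FK _]]].
have [qxi hxi] := cusp_isotropic.
have [eta [qeta xieta]] := dual_isotropic fRs fRp qxi cusp_nonzero.
have Ysep := lorentz_separated horo_hyperbolic.
have Xsep := half_space_separated GBe GBg GBd GBt.
have [y0 [Yy0 py0]] : exists y0, Y y0 /\ pY y0 = F (pX 0).
  have [d d0 [phi [_ h]]] := hF 0 half_space0; exists (phi 0); apply: h.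
  by split; [exact: half_space0|exact: ballxx].
have [Phi [cPhi hPhi'] Phi0] := exists_lift half_space_convex Ysep horo_deck hF
  half_space0 Yy0 py0.
have hPhi x : X x -> Y (Phi x) /\ pY (Phi x) = F (pX x) := hPhi' x.
exists Phi; split=> [x /hPhi[]//||g GBg'].
  pose C := horo_base fR xi eta; pose ka := horo_param fR xi.
  pose kc := horo_coord fR xi eta.
  have kaY w : C w -> Y (ka w) by apply: horo_param_in.
  have kcC y : Y y -> C (kc y) by apply: horo_coord_in.
  have kaK y : Y y -> ka (kc y) = y by apply: horo_coordK.
  have Cconv : convex_set C by apply: horo_base_convex.
  have loc w : C w -> exists2 d : R, 0 < d & exists phi,
      is_lift X pX (F' \o pY \o ka) (C `&` ball w d) phi.
    move=> Cw; have [d d0 [phi [cphi hphi]]] := hF' (ka w) (kaY w Cw).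
    have ca v : C v -> forall e : R, 0 < e -> exists2 d : R, 0 < d &
        forall y, ball v d y -> ball (ka v) e (ka y).
      by move=> [_ /andP[_ v0]]; apply: horo_param_cont; rewrite lt_eqF.
    have [d' d'0 hd'] := ca w Cw d d0.
    exists d' => //; exists (phi \o ka).
    have kaB v : (C `&` ball w d') v -> (Y `&` ball (ka w) d) (ka v).
      by move=> [Cv wv]; split; [exact: kaY|exact: hd'].
    split=> [|v /kaB/hphi//].
    apply: (cont_on_comp kaB) cphi => v [Cv _] e e0.
    by have [d1 d10 h1] := ca v Cv e e0; exists d1 => // y _ /h1.
  have [Y0 P0] : Y (Phi 0) /\ pY (Phi 0) = F (pX 0) := hPhi 0 half_space0.
  have pK : pX 0 = (F' \o pY \o ka) (kc (Phi 0)).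
    by rewrite /= kaK // P0 /= FK //; exact: half_space0.
  have [Psi [cPsi hPsi] Psi0] := exists_lift Cconv Xsep half_space_deck loc
    (kcC _ Y0) half_space0 pK.
  have inv x : X x -> Psi (kc (Phi x)) = x.
    move=> Xx; apply: (lift_unique Xsep half_space_convex (phi := Psi \o kc \o Phi)
        (psi := id) _ _ _ half_space0 Xx) => //.
    - apply: (cont_on_comp (D := C)) cPsi => [z /hPhi[/kcC]//|].
      apply: (cont_on_comp (D := setT)) cPhi _ => //.
      exact: horo_coord_cont.
    - by move=> z _ e e0; exists e.
    - move=> z Xz; have [Yz pz] : Y (Phi z) /\ pY (Phi z) = F (pX z) := hPhi z Xz.
      have [? e] := hPsi _ (kcC _ Yz).
      split=> //=; rewrite e /= kaK // pz /= FK //.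
  by move=> x y Xx Xy e; rewrite -(inv x Xx) e inv.
have Xg := @half_space_actX g.
have [Yg0 pg0] := hPhi _ (Xg _ half_space0); have [Y0 P0] : Y (Phi 0) /\ pY (Phi 0) = F (pX 0) := hPhi 0 half_space0.
have [|h [Gh h0 hxi' hY]] := horo_orbit Y0 Yg0.
  by rewrite P0 pg0 /= half_space_orbit_act.
exists h; split=> // x Xx.
apply: (lift_unique Ysep half_space_convex (phi := Phi \o half_space_act g)
  (psi := fun x => h *m Phi x) _ _ _ half_space0 Xx) => //.
- apply: (cont_on_comp (D := X)) cPhi => //.
  by apply: cont_on_sub (@half_space_act_cont _ _ _).
- apply: (@cont_on_comp _ _ _ _ X setT Phi (fun y => h *m y)) => //.
  exact: cont_on_mulmx.
- move=> z Xz /=; have [Ygz pgz] := hPhi _ (Xg _ Xz); have [Yz pz] := hPhi _ Xz.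
  split=> //; first exact: hY.
  by rewrite hyperbolic_orbit_act // -/pY pgz half_space_orbit_act.
Qed.

End CuspGroup.

(** * Discrete representations of Z^n by Euclidean isometries *)

Lemma int_lattice_ind n (P : 'cV[int]_n -> Prop) :
  P 0 -> (forall j, P (delta_mx j 0)) -> (forall x y, P x -> P y -> P (x + y)) ->
  (forall x, P x -> P (- x)) -> forall z, P z.
Proof.
move=> P0 Pd PD PN z; rewrite (matrix_sum_delta z).
elim/big_ind: _ => // i _; rewrite big_ord_recl big_ord0 addr0.
have Pn k : P (k%:Z *: delta_mx i 0).
  elim: k => [|k IH]; first by rewrite scale0r.
  by rewrite intS scalerDl scale1r; apply: PD.
by case: (z i 0) => k; rewrite ?NegzE ?scaleNr; [|apply: PN].
Qed.

Lemma additive_int_matrix (K : pzRingType) m n (c : 'cV[int]_n -> 'cV[K]_m) :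
  (forall x y, c (x + y) = c x + c y) ->
  forall z, c z = (\matrix_(i, j) c (delta_mx j 0) i 0) *m map_mx intr z.
Proof.
move=> cD; set M := \matrix_(i, j) _.
have c0 : c 0 = 0 by apply: (addIr (c 0)); rewrite -cD !add0r.
have cN x : c (- x) = - c x.
  by apply/eqP; rewrite -subr_eq0 opprK -cD addNr c0.
apply: int_lattice_ind => [|j|x y ex ey|x ex].
- by rewrite c0 map_mx0 mulmx0.
- by rewrite map_delta_mx -colE; apply/matrixP => i k; rewrite ord1 !mxE.
- by rewrite cD ex ey map_mxD mulmxDr.
- by rewrite cN ex map_mxN mulmxN.
Qed.

Lemma mulmx_entry_bound (R : realDomainType) m n (M : 'M[R]_(m, n)) (v : 'cV[R]_n)
    (c : R) i :
  (forall j, `|v j 0| <= c) -> `|(M *m v) i 0| <= (\sum_k \sum_j `|M k j|) * c.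
Proof.
move=> hv; rewrite mxE; apply: (le_trans (ler_norm_sum _ _ _)).
have c0 (j : 'I_n) : 0 <= c by apply: le_trans (hv j).
rewrite mulr_suml (bigD1 i) //= -[leLHS]addr0; apply: lerD.
  rewrite mulr_suml; apply: ler_sum => j _; rewrite normrM.
  exact: ler_wpM2l.
apply: sumr_ge0 => k _; rewrite mulr_suml; apply: sumr_ge0 => j _.
by rewrite mulr_ge0 // (c0 j).
Qed.

(** Rounding the multiples of a nonzero kernel vector would give infinitely many
    lattice points with bounded image. *)
Lemma lattice_injective (R : realType) m n (M : 'M[R]_(m, n)) :
  (forall c : R, finite_set [set z : 'cV[int]_n |
     forall i, `|(M *m map_mx intr z) i 0| <= c]) ->
  forall v : 'cV_n, M *m v = 0 -> v = 0.
Proof.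
move=> fin v Mv; apply/eqP; apply: contraT => v0.
have [j vj] : exists j, v j 0 != 0.
  apply/existsP; rewrite -negb_forall; apply: contra v0 => /forallP h.
  by apply/eqP/matrixP => i k; rewrite ord1 mxE; apply/eqP.
have vj0 : 0 < `|v j 0| by rewrite normr_gt0.
pose N := (Num.truncn `|v j 0|^-1).+1.
have Nv : 1 < N%:R * `|v j 0|.
  by rewrite -ltr_pdivrMr // div1r; apply: truncnS_gt.
pose h k : 'cV[int]_n := map_mx Num.floor ((k * N)%:R *: v).
have hE k i : `|(map_mx intr (h k) - (k * N)%:R *: v) i 0| <= 1.
  rewrite !mxE; have /andP[a1] := floor_itv ((k * N)%:R * v i 0).
  by rewrite intrD /= => a2; rewrite ler_norml; apply/andP; split; lra.
have [|k [l [kl e]]] := pigeonhole (h := h) (fin (\sum_i \sum_j `|M i j|)).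
  move=> k i /=.
  have -> : M *m map_mx intr (h k) = M *m (map_mx intr (h k) - (k * N)%:R *: v).
    by rewrite mulmxBr -scalemxAr Mv scaler0 subr0.
  by rewrite -[leRHS]mulr1; apply: mulmx_entry_bound.
move/matrixP/(_ j 0): e; rewrite !mxE => e.
have /andP[a1 a2] := floor_itv ((k * N)%:R * v j 0).
have /andP[b1 b2] := floor_itv ((l * N)%:R * v j 0).
rewrite e in a1 a2; rewrite !intrD /= in a2 b2.
have : `|((l * N)%:R - (k * N)%:R) * v j 0| < 1.
  by rewrite mulrBl ltr_norml; apply/andP; split; lra.
rewrite -natrB ?leq_mul2r ?(ltnW kl) ?orbT // -mulnBl normrM normr_nat natrM -mulrA.
have : (1 : R) <= (l - k)%:R by rewrite ler1n subn_gt0.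
move=> h1 h2; suff : (1 : R) < 1 by rewrite ltxx.
by apply: le_lt_trans h2; apply: le_trans (ltW Nv) _; rewrite ler_peMl // ltW // (lt_trans _ Nv).
Qed.

Lemma injective_unitmx (K : fieldType) n (M : 'M[K]_n) :
  (forall v : 'cV_n, M *m v = 0 -> v = 0) -> M \in unitmx.
Proof.
move=> h; rewrite -unitmx_tr -row_free_unit -kermx_eq0.
apply/eqP/row_matrixP => i; rewrite row0; apply: trmx_inj; rewrite trmx0.
apply: h; apply: trmx_inj; rewrite trmx_mul trmxK -row_mul mulmx_ker row0.
by rewrite trmx0.
Qed.

Section AbelianCocycle.
Variables (R : realType) (n : nat) (f : 'M[R]_n).
Hypotheses (fs : f^T = f) (fp : posdef f).
Variables (A : 'cV[int]_n -> 'M[R]_n) (u : 'cV[int]_n -> 'cV[R]_n).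
Hypothesis AO : forall z, (A z)^T *m f *m A z = f.
Hypothesis AD : forall x y, A (x + y) = A x *m A y.
Hypothesis uD : forall x y, u (x + y) = A x *m u y + u x.
Hypothesis ufin : forall c : R,
  finite_set [set z | forall i, `|u z i 0| <= c].

Let Aj (j : 'I_n) := A (delta_mx j 0).
Let M := \sum_j (Aj j - 1%:M).
Let U := \sum_j u (delta_mx j 0).

Lemma cocycle_lin0 : A 0 = 1%:M.
Proof.
have u0 := orthogonal_unit (posdef_unit fp) (AO 0).
by rewrite -[LHS](mulKmx u0) -AD addr0 mulVmx.
Qed.

Lemma cocycle_fixed (w : 'cV[R]_n) : (forall j, Aj j *m w = w) -> forall z, A z *m w = w.
Proof.
move=> h; apply: int_lattice_ind => //.
- by rewrite cocycle_lin0 mul1mx.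
- by move=> x y ex ey; rewrite AD -mulmxA ey ex.
- by move=> x ex; rewrite -{1}ex mulmxA -AD addNr cocycle_lin0 mul1mx.
Qed.

(** The pairing of M w with w is minus half the sum of the squared lengths of the
    vectors A_j w - w, so the kernel of M consists of common fixed vectors. *)
Lemma cocycle_kernel (w : 'cV[R]_n) : M *m w = 0 -> forall j, Aj j *m w = w.
Proof.
move=> Mw; pose q j := bil f (Aj j *m w - w) (Aj j *m w - w).
have q0 j : 0 <= q j.
  by rewrite /q; have [->|/fp/ltW//] := eqVneq (Aj j *m w - w) 0; rewrite bil0l.
have qE j : q j = - 2 * bil f ((Aj j - 1%:M) *m w) w.
  rewrite /q mulmxBl mul1mx !bilE bil_orthogonal ?AO // (bilC w _ fs); ring.
have : \sum_j q j = 0.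
  rewrite (eq_bigr _ (fun j _ => qE j)) -mulr_sumr.
  have -> : \sum_j bil f ((Aj j - 1%:M) *m w) w = bil f (M *m w) w.
    rewrite /M mulmx_suml; elim/big_ind2: _ => //; first by rewrite bil0l.
    by move=> ? ? ? ? -> ->; rewrite bilDl.
  by rewrite Mw bil0l mulr0.
move/eqP; rewrite psumr_eq0; last by move=> j _; apply: q0.
move=> /allP h j; have := h j; rewrite mem_index_enum => /(_ isT)/= /eqP qj.
apply/eqP; rewrite -subr_eq0; apply: contraT => /fp.
by rewrite -/(q j) qj ltxx.
Qed.

(** A common fixed vector of the isometries A_j is orthogonal to the image of
    each A_j - 1. *)
Lemma cocycle_kernel2 (w : 'cV[R]_n) : M *m (M *m w) = 0 -> M *m w = 0.
Proof.
move=> /cocycle_kernel; set x := M *m w => h.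
apply/eqP; apply: contraT => /fp; suff -> : bil f x x = 0 by rewrite ltxx.
rewrite {2}/x /M mulmx_suml.
have : forall j, bil f x ((Aj j - 1%:M) *m w) = 0.
  move=> j; rewrite mulmxBl mul1mx bilDr bilNr -{1}(h j) bil_orthogonal ?AO //.
  by rewrite subrr.
move=> h'; elim/big_ind: _ => //; first by rewrite bil0r.
by move=> a b ha hb; rewrite bilDr ha hb addr0.
Qed.

(** M and its square have the same kernel, hence the same image. *)
Lemma cocycle_base_point : exists e : 'cV[R]_n, M *m (U - M *m e) = 0.
Proof.
have cap0 : (M^T :&: kermx M^T)%MS = 0.
  apply/eqP/rowV0P => v; rewrite sub_capmx => /andP[/submxP[y ->] /sub_kermxP].
  move=> /(congr1 trmx); rewrite !trmx_mul !trmxK trmx0 => /cocycle_kernel2.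
  by rewrite -{1}(trmxK M) -trmx_mul => /(congr1 trmx); rewrite trmxK trmx0.
have := mxrank_mul_ker M^T M^T; rewrite cap0 mxrank0 addn0 => rk.
have := mxrank_leqif_sup (submxMl M^T M^T); rewrite rk => /leqif_refl.
move=> /(submx_trans (submxMl U^T M^T))/submxP[e eE]; exists e^T.
apply: trmx_inj; rewrite trmx_mul linearB /= trmx_mul trmxK mulmxBl eE trmx0.
by rewrite mulmxA subrr.
Qed.

(** The isometries attached to x and to y commute. *)
Lemma cocycle_commute x y :
  (A x - 1%:M) *m u y = (A y - 1%:M) *m u x.
Proof.
have := uD x y; rewrite addrC uD !mulmxBl !mul1mx => e.
by apply/eqP; rewrite subr_eq addrAC -subr_eq opprK e.
Qed.

(** Bieberbach's first theorem for abelian groups of maximal rank. After moving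
    the origin to the base point e, all displacements lie in the common fixed
    space of the linear parts; they form a lattice of rank n, so this space is
    everything. *)
Theorem abelian_cocycle_translations :
  (forall z, A z = 1%:M) /\
  exists2 t : 'M[R]_n, t \in unitmx & forall z, u z = t *m map_mx intr z.
Proof.
have [e Me] := cocycle_base_point.
have Acom x y : A x *m A y = A y *m A x by rewrite -!AD addrC.
have MA z : M *m (A z - 1%:M) = (A z - 1%:M) *m M.
  rewrite /M mulmx_suml mulmx_sumr; apply: eq_bigr => j _.
  rewrite !mulmxBl !mulmxBr !mul1mx !mulmx1 /Aj Acom.
  by apply/matrixP => a b; rewrite !mxE; ring.
have Mu z : M *m u z = (A z - 1%:M) *m U.
  rewrite /M /U mulmx_suml mulmx_sumr; apply: eq_bigr => j _.
  exact: cocycle_commute.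
pose v z := u z - (A z - 1%:M) *m e.
have Mv z : M *m v z = 0.
  rewrite /v mulmxBr Mu mulmxA MA -mulmxA -mulmxBr mulmxBl mul1mx.
  by rewrite (cocycle_fixed (cocycle_kernel Me)) subrr.
have Av x y : A x *m v y = v y by apply/cocycle_fixed/cocycle_kernel.
have vD x y : v (x + y) = v x + v y.
  rewrite -(Av x y) /v uD AD !mulmxBl !mul1mx !mulmxBr mulmxA.
  apply/matrixP => i j; rewrite !mxE; ring.
set t := \matrix_(i, j) v (delta_mx j 0) i 0.
have vE z : v z = t *m map_mx intr z by apply: additive_int_matrix.
have vfin (c : R) : finite_set [set z : 'cV[int]_n |
     forall i, `|(t *m map_mx intr z) i 0| <= c].
  pose d := \sum_i (1 + `|invmx f i i| * `|bil f e e| + `|e i 0|).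
  apply: sub_finite_set (ufin (c + d)) => z /= hz i.
  have -> : u z i 0 = (t *m map_mx intr z) i 0 + ((A z *m e) i 0 - e i 0).
    by rewrite -vE /v mulmxBl mul1mx; move: (A z *m e) => w; rewrite !mxE; ring.
  apply: (le_trans (ler_normD _ _)); apply: lerD => //.
  apply: (le_trans (ler_normB _ _)); rewrite /d (bigD1 i) //= -[leLHS]addr0.
  apply: lerD; last by apply: sumr_ge0 => k _; rewrite !addr_ge0 ?mulr_ge0.
  rewrite lerD2r; have := coord_sqr_le (A z *m e) i fs (posdef_unit fp) fp.
  rewrite bil_orthogonal ?AO // => h.
  have h1 : `|(A z *m e) i 0| ^+ 2 <= `|invmx f i i| * `|bil f e e|.
    by rewrite real_normK ?num_real // (le_trans h) // -normrM ler_norm.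
  have := normr_ge0 ((A z *m e) i 0); move: `|_| h1 => a h1 a0; nra.
have tu : t \in unitmx by apply/injective_unitmx/lattice_injective.
have Mt : M *m t = 0.
  apply/matrixP => i j; have /matrixP/(_ i 0) := Mv (delta_mx j 0).
  rewrite !mxE => h; rewrite -[RHS]h; apply: eq_bigr => k _; rewrite !mxE.
  by congr (_ * _); rewrite /t mxE.
have M0 : M = 0 by rewrite -[M](mulmxK tu) Mt mul0mx.
have A1 z : A z = 1%:M.
  apply: mulmx_inj_col => w; rewrite mul1mx.
  by apply/cocycle_fixed/cocycle_kernel; rewrite M0 mul0mx.
by split=> //; exists t => // z; rewrite -vE /v A1 subrr mul0mx subr0.
Qed.

End AbelianCocycle.

(** * Unipotent lattices in the cusp stabilizer *)

(** The point eta0 + xi0 / 2 of the hyperboloid has the origin as image under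
    [flat_proj]; the position of g (eta0 + xi0 / 2) is bounded in terms of the
    translation vector of g. *)
Lemma trans_part_base (K : realFieldType) n (f : 'M[K]_n) g :
  f^T = f -> cusp_stabilizer f g ->
  let b0 := eta0 K n + 2^-1 *: xi0 K n in
  g *m b0 = ((1 + bil f (trans_part g) (trans_part g)) / 2) *: xi0 K n + eta0 K n
            + flat_incl (trans_part g).
Proof.
move=> fs gS b0; have Qs := qform_sym fs; set Q := qform f in Qs.
have qb : bil Q b0 b0 = -1.
  rewrite /b0 !bilE bil_xi0_xi0 bil_eta0_eta0 (bilC (eta0 K n) _ Qs) bil_xi0_eta0.
  by field.
have bx : bil Q (g *m b0) (xi0 K n) = -1.
  rewrite cusp_stabilizer_bil // /b0 !bilE bil_xi0_xi0 (bilC _ _ Qs) bil_xi0_eta0.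
  by ring.
have pb : flat_proj (g *m b0) = trans_part g.
  rewrite /b0 mulmxDr -scalemxAr (proj2 gS) flat_projD flat_projZ flat_proj_xi0.
  by rewrite scaler0 addr0.
have be : bil Q (g *m b0) (eta0 K n) = - ((1 + bil f (trans_part g) (trans_part g)) / 2).
  have := bil_decomposition fs (g *m b0) (g *m b0).
  rewrite -/Q bil_orthogonal ?(proj1 gS) // qb bx pb => h; lra.
rewrite {1}(flat_decomposition f (g *m b0)) -/Q bx be pb.
by rewrite opprK scaleN1r opprK.
Qed.

Lemma qform_base (K : realFieldType) n (f : 'M[K]_n) : f^T = f ->
  let b0 := eta0 K n + 2^-1 *: xi0 K n in bil (qform f) b0 b0 = -1.
Proof.
move=> fs b0; rewrite /b0 !bilE bil_xi0_xi0 bil_eta0_eta0.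
by rewrite (bilC (eta0 K n) _ (qform_sym fs)) bil_xi0_eta0; field.
Qed.

Section Lattice.
Variables (R : realType) (n : nat) (f : 'M[R]_n).
Hypotheses (fs : f^T = f) (fp : posdef f).
Let Q := qform f.
Variable G : set 'M[R]_(n + 1 + 1).
Hypotheses (Gg : matrix_group G) (Gd : discrete_group G).
Hypothesis GO : forall g, G g -> g^T *m Q *m g = Q.

(** Properness bounds the entries of g, and also those of its inverse, which moves
    g z back to z. *)
Lemma discrete_proper z (c : R) : bil Q z z = -1 ->
  finite_set [set g | G g /\ `|height (g *m z)| <= c].
Proof.
move=> qz; pose c' := `|c| + `|height z|.
have [d hd] := isometry_bound (cone_sym fs) (cone_unit fp) (cone_posdef fp) c'.
have hc (g : 'M[R]_(n + 1 + 1)) : `|height (g *m z)| <= c -> `|height (g *m z)| <= c'.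
  move=> h; rewrite /c' (le_trans h) // (le_trans (ler_norm _)) //.
  by rewrite lerDl.
have hz : `|height z| <= c' by rewrite /c' lerDr.
pose B := [set g | [/\ G g, forall i j, `|g i j| <= d & forall i j, `|invmx g i j| <= d]].
apply: (@sub_finite_set _ _ B).
  move=> g [Gg' hg]; have gu := matrix_group_unit Gg Gg'; split=> //.
    by apply: (hd g z) => //; [exact: GO|exact: hc].
  apply: (hd (invmx g) (g *m z)).
  - by apply: GO; apply: matrix_groupV.
  - by rewrite bil_orthogonal; [exact: qz|exact: GO].
  - exact: hc.
  - by rewrite mulKmx.
apply: (discrete_bounded_finite Gg (discrete_isolated1 Gg Gd) (k := d)).
- by move=> g [].
- by move=> g [Gg' h1 h2]; split=> //; [exact: matrix_groupV|rewrite invmxK].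
- by move=> g [].
Qed.

Variables (k : 'cV[int]_n -> 'M[R]_(n + 1 + 1)) (xi : 'cV[R]_(n + 1 + 1)).
Hypotheses (kG : forall z, G (k z)) (kxi : forall z, k z *m xi = xi).
Hypotheses (kD : forall x y, k (x + y) = k x *m k y) (kinj : injective k).

Section Frame.
Variables (S : 'M[R]_(n + 1 + 1)) (c : R).
Hypotheses (SQ : S^T *m Q *m S = Q) (Sxi : S *m xi0 R n = c *: xi).

Let Su : S \in unitmx := orthogonal_unit (qform_unit fp) SQ.

(** The isometry S moves xi0 to the line of xi, so this conjugation carries the
    elements fixing xi to elements fixing xi0. *)
Definition frame_conj (g : 'M[R]_(n + 1 + 1)) := invmx S *m g *m S.

Lemma frame_conjM g h : frame_conj (g *m h) = frame_conj g *m frame_conj h.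
Proof. by rewrite /frame_conj !mulmxA mulmxK. Qed.

Lemma frame_conj_stabilizer g : G g -> g *m xi = xi ->
  cusp_stabilizer f (frame_conj g).
Proof.
move=> Gg' gxi; have ViQ : (invmx S)^T *m Q *m invmx S = Q.
  by apply: orthogonal_bil => x y; rewrite -(bil_orthogonal _ _ SQ) !mulKVmx.
split; first by apply: orthogonalM => //; apply: orthogonalM => //; apply: GO.
rewrite /frame_conj -!mulmxA Sxi -scalemxAr gxi -Sxi mulKmx //.
Qed.

Let kS z : cusp_stabilizer f (frame_conj (k z)).
Proof. exact: frame_conj_stabilizer. Qed.

(** Discreteness of the lattice, read off from the translation vectors: bounded
    vectors mean bounded displacement of the base point S (eta0 + xi0 / 2). *)
Lemma frame_finite (d : R) :
  finite_set [set z | forall i, `|trans_part (frame_conj (k z)) i 0| <= d].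
Proof.
pose b0 := eta0 R n + 2^-1 *: xi0 R n.
pose I := col_mx (col_mx 1%:M 0) 0 : 'M[R]_(n + 1 + 1, n).
have IE u : flat_incl u = I *m u by rewrite /I !mul_col_mx mul1mx !mul0mx.
pose row_bound m (M : 'M[R]_(m, n)) : R := \sum_i \sum_j `|M i j|.
pose d2 : R := \sum_(j < n) d * (row_bound _ f * d).
have qb (u : 'cV[R]_n) : (forall i, `|u i 0| <= d) -> `|bil f u u| <= d2.
  move=> hu; rewrite /bil -mulmxA mxE; apply: (le_trans (ler_norm_sum _ _ _)).
  rewrite /d2; apply: ler_sum => j _; rewrite normrM mxE.
  by apply: ler_pM => //; apply: mulmx_entry_bound.
pose h0 := `|height (S *m xi0 R n)|; pose h1 := `|height (S *m eta0 R n)|.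
pose e := (1 + d2) / 2 * h0 + h1 + row_bound _ (S *m I) * d.
have hb0 : bil Q (S *m b0) (S *m b0) = -1 by rewrite bil_orthogonal // qform_base.
apply: (finite_set_of_inj (h := k) (discrete_proper e hb0)); last first.
  by move=> x y _ _ /kinj.
move=> z hz; split=> //.
have -> : k z *m (S *m b0) = S *m (frame_conj (k z) *m b0).
  by rewrite /frame_conj !mulmxA mulmxV // mul1mx.
rewrite (trans_part_base fs (kS z)); set u := trans_part _ in hz *.
rewrite !mulmxDr -!scalemxAr IE mulmxA.
have hD x y : height (x + y) = height x + height y :> R.
  by rewrite /height linearD mxE.
have hZ a x : height (a *: x) = a * height x :> R.
  by rewrite /height linearZ mxE.
rewrite !hD hZ /e; apply: (le_trans (ler_normD _ _)); apply: lerD; last first.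
  by rewrite /height mxE; apply: mulmx_entry_bound.
apply: (le_trans (ler_normD _ _)); rewrite lerD2r normrM ler_wpM2r //.
have := qb _ hz; rewrite ler_norml => /andP[q1 q2].
by rewrite ler_norml; apply/andP; split; lra.
Qed.

Lemma frame_lattice :
  (forall z, lin_part (frame_conj (k z)) = 1%:M) /\
  exists2 t : 'M[R]_n, t \in unitmx &
    forall z, trans_part (frame_conj (k z)) = t *m map_mx intr z.
Proof.
apply: (abelian_cocycle_translations fs fp).
- by move=> z; apply: lin_part_orthogonal.
- by move=> x y; rewrite kD frame_conjM (lin_partM (kS x) (kS y)).
- by move=> x y; rewrite kD frame_conjM (trans_partM fs (kS x) (kS y)).
- exact: frame_finite.
Qed.

End Frame.
End Lattice.

(** * Rationality of the cusp *)

Lemma to_real_qform (R : realType) n (f : 'M[rat]_n) :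
  to_real R (qform f) = qform (to_real R f).
Proof. exact: to_real_lorentz. Qed.

Lemma to_real_xi0 (R : realType) n : to_real R (xi0 rat n) = xi0 R n.
Proof. by rewrite /to_real /xi0 !map_col_mx map_mx0 !map_scalar_mx rmorph1. Qed.

Lemma to_real_eta0 (R : realType) n : to_real R (eta0 rat n) = eta0 R n.
Proof.
rewrite /to_real /eta0 !map_col_mx map_mx0 !map_scalar_mx.
by rewrite rmorphN fmorphV rmorph_nat.
Qed.

Lemma to_real_inj (R : realType) m n : injective (@to_real R m n).
Proof.
move=> A B /matrixP h; apply/matrixP => i j.
by have := h i j; rewrite !mxE => /fmorph_inj.
Qed.

(** Two powers of g lie in the same coset of the intersection. *)
Lemma commensurable_power (R : realType) n (G G' : set 'M[R]_n) g :
  matrix_group G -> matrix_group G' -> commensurable G G' -> G g ->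
  exists2 m, (0 < m)%N & G' (g ^+ m).
Proof.
move=> Gg G'g [fin _] Gg'.
have [|i [j [ij e]]] := pigeonhole (h := fun i => left_coset (G `&` G') (g ^+ i)) fin.
  by move=> i; exists (g ^+ i) => //; apply: matrix_groupX.
have gu := matrix_group_unit Gg (matrix_groupX Gg i Gg').
have : left_coset (G `&` G') (g ^+ i) (g ^+ j).
  rewrite e; exists 1%:M; last by rewrite mulmx1.
  by split; apply: matrix_group1.
move=> [h [_ G'h]]; rewrite -(subnKC (ltnW ij)) exprD => hE.
exists (j - i)%N; first by rewrite subn_gt0.
by rewrite -[_ ^+ _](mulKmx gu) -[X in _ *m X]/(_ * _) -hE mulKmx.
Qed.

Section Arithmetic.
Variables (R : realType) (n : nat) (f : 'M[rat]_n).
Hypotheses (fs : f^T = f) (fpos : positive_definite f).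
Variables G G' : set 'M[R]_(n + 1 + 1).
Hypotheses (Gg : matrix_group G) (Gd : discrete_group G).
Let fR := to_real R f.
Let Q := qform fR.
Hypothesis GO : forall g, G g -> g^T *m Q *m g = Q.
Hypotheses (G'g : matrix_group G') (GG' : commensurable G G').
Hypothesis G'rat : forall g, G' g -> exists B : 'M[rat]_(n + 1 + 1), g = to_real R B.
Variables (k : 'cV[int]_n -> 'M[R]_(n + 1 + 1)) (xi : 'cV[R]_(n + 1 + 1)).
Hypotheses (qxi : bil Q xi xi = 0) (xi_n0 : xi != 0).
Hypotheses (kG : forall z, G (k z)) (kxi : forall z, k z *m xi = xi).
Hypotheses (kD : forall x y, k (x + y) = k x *m k y) (kinj : injective k).

Let fRs : fR^T = fR := to_real_sym R fs.
Let fRp : posdef fR := @posdef_real R n f fs fpos.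

Lemma lattice_power z m : k (z *+ m.+1) = k z ^+ m.+1.
Proof.
elim: m => [|m IH]; first by rewrite mulr1n expr1.
by rewrite mulrS kD IH [RHS]exprS.
Qed.

Lemma rational_power z : exists m (B : 'M[rat]_(n + 1 + 1)),
  k (z *+ m.+1) = to_real R B.
Proof.
have [[//|m] _ /G'rat[B BE]] := commensurable_power Gg G'g GG' (kG z).
by exists m, B; rewrite lattice_power.
Qed.

Lemma map_intr_muln m (z : 'cV[int]_m) i :
  map_mx intr (z *+ i) = i%:R *: map_mx intr z :> 'cV[R]_m.
Proof. by apply/matrixP => a b; rewrite !mxE mulmxnE rmorphMn /= mulr_natl. Qed.

(** Some power of a translation in the lattice is a rational unipotent matrix u,
    and the line of xi is the image of (u - 1)^2. *)
Lemma rational_cusp : (0 < n)%N ->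
  exists (x : 'cV[rat]_(n + 1 + 1)) a, a != 0 /\ to_real R x = a *: xi.
Proof.
move=> n0; have [S [c [SQ c0 Sxi]]] := isotropic_transitive fRs fRp xi_n0 qxi.
have Su := orthogonal_unit (qform_unit fRp) SQ.
have [A1 [t tu tE]] := frame_lattice fRs fRp Gg Gd GO kG kxi kD kinj SQ Sxi.
pose e : 'cV[int]_n := delta_mx (Ordinal n0) 0.
have [m [B BE]] := rational_power e; set z := e *+ m.+1 in BE.
have kS := frame_conj_stabilizer fRp GO SQ Sxi (kG z) (kxi z).
set g := frame_conj S (k z) in kS.
have gk : (k z - 1%:M) *m (k z - 1%:M) = S *m ((g - 1%:M) *m (g - 1%:M)) *m invmx S.
  have -> : g - 1%:M = invmx S *m (k z - 1%:M) *m S.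
    by rewrite mulmxBr mulmxBl mulmx1 mulVmx.
  by rewrite !mulmxA mulmxV // mul1mx mulmxK // mulmxK.
have u0 : trans_part g != 0.
  rewrite tE; apply/eqP => /(congr1 (mulmx (invmx t))).
  rewrite mulKmx // mulmx0 map_intr_muln map_delta_mx => /matrixP/(_ (Ordinal n0) 0).
  by rewrite !mxE !eqxx mulr1 => /eqP; rewrite pnatr_eq0.
have N0 : (k z - 1%:M) *m (k z - 1%:M) != 0.
  apply: contraTneq (fRp u0) => N0.
  have := unipotent_square_eta0 fRs kS (A1 z).
  have -> : (g - 1%:M) *m (g - 1%:M) = 0.
    by rewrite -[LHS](mulKmx Su) -[X in _ *m X](mulmxKV Su) -gk N0 mul0mx mulmx0.
  by rewrite mul0mx bil0l => /esym/eqP; rewrite oppr_eq0 => /eqP ->; rewrite ltxx.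
have [j Nj] : exists j : 'I_(n + 1 + 1),
    (k z - 1%:M) *m (k z - 1%:M) *m (delta_mx j 0 : 'cV[R]_(n + 1 + 1)) != 0.
  apply/existsP; rewrite -negb_forall; apply: contra N0 => /forallP h.
  apply/eqP/matrixP => a b; have /eqP/matrixP/(_ a 0) := h b.
  by rewrite -colE !mxE.
have [d dE] := unipotent_square (invmx S *m (delta_mx j 0 : 'cV[R]_(n + 1 + 1))) kS (A1 z).
have NE : (k z - 1%:M) *m (k z - 1%:M) *m (delta_mx j 0 : 'cV[R]_(n + 1 + 1)) =
    (d * c) *: xi.
  by rewrite -mulmxA in dE; rewrite gk -!mulmxA dE -scalemxAr Sxi scalerA.
exists ((B - 1%:M) *m (B - 1%:M) *m delta_mx j 0), (d * c); split.
  by apply: contra_neq Nj => e0; rewrite NE e0 scale0r.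
rewrite -NE /to_real !map_mxM map_mxB map_mx1 map_delta_mx.
by rewrite -[map_mx _ B]/(to_real R B) -BE.
Qed.

Lemma rational_frame : (0 < n)%N ->
  exists (S : 'M[rat]_(n + 1 + 1)) (c : R),
    [/\ S^T *m qform f *m S = qform f, c != 0 & to_real R S *m xi0 R n = c *: xi].
Proof.
move=> /rational_cusp[x [a [a0 xE]]].
have qx : bil (qform f) x x = 0.
  apply/eqP; rewrite -(fmorph_eq0 (@ratr R)); apply/eqP.
  transitivity (bil Q (to_real R x) (to_real R x)).
    by rewrite /Q -to_real_qform bil_to_real.
  by rewrite xE !bilE qxi !mulr0.
have x0 : x != 0.
  apply: contra_neq xi_n0 => x0; have := xE; rewrite x0 /to_real map_mx0.
  by move/esym/eqP; rewrite scaler_eq0 (negbTE a0) => /eqP.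
have [S [c [SQ c0 Sx]]] := isotropic_transitive fs fpos x0 qx.
exists S, (ratr c * a); split=> //; first by rewrite mulf_neq0 // fmorph_eq0.
by rewrite -to_real_xi0 /to_real -map_mxM Sx map_mxZ -[map_mx _ x]/(to_real R x) xE scalerA.
Qed.

(** In a rational frame the translation lattice is rational, so conjugation by
    an element g of the cusp group acts on it by a rational matrix. This matrix is
    also the linear part of g, which is an isometry of f. *)
Lemma rational_holonomy : exists2 t : 'M[R]_n, t \in unitmx &
  forall g (M : 'M[int]_n), G g -> g *m xi = xi ->
    (forall z, g *m k z = k (M *m z) *m g) ->
    @rational_orthogonal_group R n f (t *m map_mx intr M *m invmx t).
Proof.
have [n0|n0] := posnP n.
  (* in dimension 0 there are no translations to make the cusp rational, but the
     conclusion is about empty matrices *)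
  exists 1%:M => [|g M _ _ _]; first exact: unitmx1.
  exists 1%:M; last by apply/matrixP => -[i hi]; exfalso; rewrite n0 in hi.
  by split; [exact: unitmx1|rewrite trmx1 mul1mx mulmx1].
have [Sq [c [SqQ c0 Sxi]]] := rational_frame n0.
set S := to_real R Sq in Sxi.
have Squ : Sq \in unitmx.
  by apply: orthogonal_unit SqQ; apply: qform_unit.
have SQ : S^T *m Q *m S = Q.
  by rewrite /S /Q -to_real_qform /to_real matrix.map_trmx -!map_mxM SqQ.
have Su := orthogonal_unit (qform_unit fRp) SQ.
have [A1 [t tu tE]] := frame_lattice fRs fRp Gg Gd GO kG kxi kD kinj SQ Sxi.
have conj_stab := frame_conj_stabilizer fRp GO SQ Sxi.
(* the columns of t are rational *)
have [tq tqE] : exists tq : 'M[rat]_n, t = to_real R tq.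
  have col j : exists x : 'cV[rat]_n, t *m (delta_mx j 0 : 'cV[R]_n) = to_real R x.
    have [m [B BE]] := rational_power (delta_mx j 0).
    exists (m.+1%:R^-1 *: flat_proj (invmx Sq *m B *m Sq *m eta0 rat n)).
    have := tE (delta_mx j 0 *+ m.+1).
    rewrite map_intr_muln map_delta_mx -scalemxAr => e.
    have -> : t *m (delta_mx j 0 : 'cV[R]_n) =
        m.+1%:R^-1 *: trans_part (frame_conj S (k (delta_mx j 0 *+ m.+1))).
      by rewrite e scalerA mulVf ?scale1r // pnatr_eq0.
    rewrite BE /frame_conj /trans_part /S -to_real_eta0 /to_real.
    rewrite -map_invmx -!map_mxM map_mxZ fmorphV rmorph_nat; congr (_ *: _).
    by rewrite /flat_proj !map_usubmx.
  have /choice[x xE] := col.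
  exists (\matrix_(i, j) x j i 0); apply/matrixP => i j.
  by have /matrixP/(_ i 0) := xE j; rewrite -colE !mxE.
exists t => // g M Gg' gxi gM.
have gS := conj_stab g Gg' gxi.
have kS z := conj_stab (k z) (kG z) (kxi z).
set A := lin_part (frame_conj S g).
have AE : A = t *m map_mx intr M *m invmx t.
  apply: (canRL (mulmxK tu)); apply/matrixP => i j.
  have := congr1 (fun h => trans_part (frame_conj S h)) (gM (delta_mx j 0)).
  rewrite !(frame_conjM fRp SQ) (trans_partM fRs gS (kS _)).
  rewrite (trans_partM fRs (kS _) gS).
  rewrite A1 mul1mx addrC => /addrI; rewrite !tE map_mxM map_delta_mx !mulmxA.
  by rewrite -!colE => /matrixP/(_ i 0); rewrite !mxE.
rewrite -AE; pose Aq := tq *m map_mx intr M *m invmx tq.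
have AqE : to_real R Aq = A.
  rewrite AE /Aq tqE /to_real !map_mxM map_invmx; congr (_ *m _ *m _).
  by apply/matrixP => i j; rewrite !mxE rmorph_int.
clearbody Aq; have AqO : Aq^T *m f *m Aq = f.
  apply: (@to_real_inj R); have := lin_part_orthogonal fRs gS.
  by rewrite -/A -AqE /fR /to_real matrix.map_trmx -!map_mxM.
exists Aq => //; split=> //; apply: orthogonal_unit AqO.
exact: posdef_unit.
Qed.

End Arithmetic.

(** * The holonomy of the flat manifold *)

Section IntegralHolonomy.
Variables (R : realType) (n : nat) (GB : set 'M[R]_(n + 1)).
Hypotheses (GBe : GB `<=` @euclidean_isometries R n) (GBg : matrix_group GB).
Variable tau : 'cV[int]_n -> 'M[R]_(n + 1).
Hypothesis htau : lattice_identification GB tau.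

Lemma lattice_translation z : GB (tau z) /\ ulsubmx (tau z) = 1%:M.
Proof. by have [[h _ _] _] := htau; apply: h. Qed.

Lemma lattice_inj : injective tau.
Proof. by have [[_ h _] _] := htau; move=> x y; apply: h; rewrite inE. Qed.

Lemma lattice_surj g : GB g -> ulsubmx g = 1%:M -> exists z, tau z = g.
Proof. by have [[_ _ h] _] := htau => Gg g1; have [z _ <-] := h g (conj Gg g1); exists z. Qed.

Lemma lattice_additive x y : tau (x + y) = tau x *m tau y.
Proof. by have [_ h] := htau. Qed.

Lemma lattice_conj g z : GB g -> exists w, tau w = g *m tau z *m invmx g.
Proof.
move=> Gg; have [Gz z1] := lattice_translation z.
have GV := matrix_groupV GBg Gg; have gu := matrix_group_unit GBg Gg.
apply: lattice_surj; first by do 2?apply: matrix_groupM => //.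
rewrite (euclidean_ulsubM (GBe _) (GBe GV)); last exact: matrix_groupM.
rewrite (euclidean_ulsubM (GBe Gg) (GBe Gz)) z1 mulmx1.
rewrite -(euclidean_ulsubM (GBe Gg) (GBe GV)) mulmxV // scalar_mx_block.
by rewrite block_mxKul.
Qed.

Lemma conjugation_matrix g : GB g ->
  exists M : 'M[int]_n, forall z, g *m tau z *m invmx g = tau (M *m z).
Proof.
move=> Gg; have /choice[c cE] := fun z => lattice_conj z Gg.
have gu := matrix_group_unit GBg Gg.
exists (\matrix_(i, j) c (delta_mx j 0) i 0) => z; rewrite -cE; congr tau.
rewrite {1}(additive_int_matrix (c := c)) => [|x y].
  by congr (_ *m _); apply/matrixP => i j; rewrite mxE intz.
apply: lattice_inj; rewrite lattice_additive !cE lattice_additive.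
by rewrite !mulmxA mulmxKV.
Qed.

Lemma conjugation_matrix_unit g (M : 'M[int]_n) : GB g ->
  (forall z, g *m tau z *m invmx g = tau (M *m z)) -> M \in unitmx.
Proof.
move=> Gg hM; have [M' hM'] := conjugation_matrix (matrix_groupV GBg Gg).
have gu := matrix_group_unit GBg Gg.
suff : M *m M' = 1%:M by move=> /mulmx1_unit[].
apply/matrixP => i j.
suff /matrixP/(_ i 0) : M *m M' *m (delta_mx j 0 : 'cV_n) = delta_mx j 0.
  by rewrite -colE !mxE eqxx andbT.
apply: lattice_inj; rewrite -mulmxA -hM -hM' invmxK !mulmxA mulmxV // mul1mx.
by rewrite mulmxK.
Qed.

(** Translations commute, so the conjugation depends on the coset only. *)
Lemma exists_rho_hol : exists rho, rho_hol GB tau rho.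
Proof.
pose coset := left_coset (translations GB).
suff /choice[rho hrho] : forall H, exists M : 'M[int]_n, forall g, GB g ->
    coset g = H -> forall z, g *m tau z *m invmx g = tau (M *m z).
  exists rho => g Gg; have h := hrho _ g Gg erefl; split=> //.
  exact: conjugation_matrix_unit h.
move=> H; have [[g0 [Gg0 <-]]|no] := pselect (exists g0, GB g0 /\ coset g0 = H); last first.
  by exists 1%:M => g Gg gH; case: no; exists g.
have [M hM] := conjugation_matrix Gg0; exists M => g Gg gH z; rewrite -hM.
have : coset g g by exists 1%:M; rewrite ?mulmx1 //; split;
  [exact: matrix_group1|rewrite scalar_mx_block block_mxKul].
rewrite gH => -[t [Gt t1] <-]; have [w <-] := lattice_surj Gt t1.
have wu := matrix_group_unit GBg (proj1 (lattice_translation w)).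
have g0u := matrix_group_unit GBg Gg0.
apply: (canLR (mulmxK _)); first by rewrite unitmx_mul g0u wu.
rewrite -[LHS]mulmxA -lattice_additive addrC lattice_additive !mulmxA.
by rewrite mulmxKV.
Qed.

End IntegralHolonomy.

Theorem theorem1p2 (R : realType) (n : nat)
    (GB : set 'M[R]_(n + 1)) (hB : compact_flat_manifold_group GB)
    (tau : 'cV[int]_n -> 'M[R]_(n + 1)) (htau : lattice_identification GB tau)
    (f : 'M[rat]_n) (hf : rational_quadratic_form f)
    (hpos : positive_definite f)
    (G : set 'M[R]_(n + 1 + 1))
    (hG : quasi_arithmetic_manifold_group (osum f (form1 1%R)) G)
    (hcusp : cusp_cross_section (osum f (form1 1%R)) GB G) :
  exists sigma : set 'M[R]_(n + 1) -> 'M[R]_n,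
    holonomy_representation GB tau sigma /\
    (forall h, holonomy_group GB h -> @rational_orthogonal_group R n f (sigma h)).
Proof.
have [GBe GBg GBd GBt _] := hB; have [fs _] := hf.
have [[GO Gg] Gd Gt _ [G' [G'rat G'g GG']]] := hG.
have [xi [xi_cusp /(cusp_embedding GBe GBg GBd GBt fs hpos Gg Gd Gt GO xi_cusp)]] := hcusp.
move=> [Phi [Phi_horo Phi_inj Phi_equiv]].
have /choice[theta thetaE] : forall g, exists h, GB g -> [/\ G h, h *m xi = xi &
    forall x, half_space x -> Phi (half_space_act g x) = h *m Phi x].
  move=> g; have [/Phi_equiv[h hh]|nGB] := pselect (GB g); first by exists h.
  by exists 0.
have O_orth := Oplus_orthogonal GO.
have qPhi x : half_space x -> bil (qform (to_real R f)) (Phi x) (Phi x) = -1.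
  by move=> /Phi_horo[].
have X0 := half_space0 R n.
have theta_unique h h' : G h -> G h' -> h *m Phi 0 = h' *m Phi 0 -> h = h'.
  move=> Gh Gh' e; have hu := matrix_group_unit Gg Gh.
  rewrite -[LHS]mulmx1 -(lorentz_free (g := invmx h *m h') (y := Phi 0) fs hpos Gg Gd Gt GO).
  - by rewrite mulKVmx.
  - exact/(matrix_groupM Gg)/Gh'/(matrix_groupV Gg).
  - exact: qPhi.
  - by rewrite -mulmxA -e mulKmx.
have theta_mul g g' : GB g -> GB g' -> theta (g *m g') = theta g *m theta g'.
  move=> Gg1 Gg2; have [G1 _ e1] := thetaE _ Gg1; have [G2 _ e2] := thetaE _ Gg2.
  have [G12 _ e12] := thetaE _ (matrix_groupM GBg Gg1 Gg2).
  apply: theta_unique => //; first exact: matrix_groupM.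
  rewrite -e12 // (half_space_actM GBe) // e1; last exact: half_space_actX.
  by rewrite e2 // mulmxA.
pose k z := theta (tau z).
have tauG z : GB (tau z) by have [] := lattice_translation htau z.
have [kG kxi] : (forall z, G (k z)) /\ (forall z, k z *m xi = xi).
  by split=> z; have [] := thetaE _ (tauG z).
have kD x y : k (x + y) = k x *m k y.
  by rewrite /k (lattice_additive htau) theta_mul.
have kinj : injective k.
  move=> x y kxy; apply: (lattice_inj htau).
  have : half_space_act (tau x) 0 = half_space_act (tau y) 0.
    apply: Phi_inj; [exact: half_space_actX..|].
    have [_ _ ->//] := thetaE _ (tauG x); have [_ _ ->//] := thetaE _ (tauG y).
    by rewrite -/(k x) kxy.
  rewrite /half_space_act /affine_act !linear0 ?mulmx0 !add0r => /eq_col_mx[e _].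
  have e' : ulsubmx (tau x) = ulsubmx (tau y).
    by rewrite !(proj2 (lattice_translation htau _)).
  have h := euclidean_eq (GBe _ (tauG x)) (GBe _ (tauG y)) e'.
  exact: h e.
have [qxi hxi] := cusp_isotropic xi_cusp; have xi_n0 := cusp_nonzero xi_cusp.
have G'real g : G' g -> exists B : 'M[rat]_(n + 1 + 1), g = to_real R B.
  by move=> /G'rat[_ [B [_ ->]]]; exists B.
have [t tu ht] := rational_holonomy fs hpos Gg Gd O_orth G'g GG' G'real qxi xi_n0
  kG kxi kD kinj.
have [rho hrho] := exists_rho_hol GBe GBg htau.
exists (fun h => t *m map_mx intr (rho h) *m invmx t); split.
  by exists rho, t.
move=> _ [g Gg1 <-]; have [_ conj_tau] := hrho g Gg1.
have [Gth thxi _] := thetaE _ Gg1; apply: ht Gth thxi _ => z.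
rewrite /k -!theta_mul // -conj_tau mulmxKV //.
exact: matrix_group_unit GBg _ _.
Qed.
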